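(* Let $U\subset\mathbb{C}^2$ be a nonempty connected open subset and let $L$ be a finite dimensional complex Lie subalgebra of the Lie algebra of complex analytic vector fields on $U$. Suppose that $L=S\ltimes R$ is a proper Levi decomposition, where $S$ is a nonzero semisimple subalgebra and $R$, the solvable radical of $L$, is nonzero. Then $S$ is isomorphic to $\mathfrak{sl}(2,\mathbb{C})$.
   Context: A complex analytic vector field on an open subset $U\subset\mathbb{C}^2$ is an expression $V=a_1\,\partial/\partial x_1+a_2\,\partial/\partial x_2$ with $a_1,a_2$ complex analytic functions on $U$, acting on analytic functions by $V(f)=\sum_i a_i\,\partial f/\partial x_i$. The bracket is $[V,W](f)=V(W(f))-W(V(f))$, which makes the space of all such vector fields a complex Lie algebra. A Levi decomposition $L=S\ltimes R$ is a vector space direct sum of a semisimple subalgebra $S$ and the solvable radical $R$ (the maximal solvable ideal) of $L$; it is called proper if both $S$ and $R$ are nonzero. *)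

(* Defs.v *)
From HB Require Import structures.
From mathcomp Require Import all_boot all_order all_algebra.
From mathcomp Require Import complex.
From mathcomp Require Import all_classical all_reals all_analysis.
From mathcomp Require Import ring.

Set Implicit Arguments.
Unset Strict Implicit.
Unset Printing Implicit Defensive.

Import Order.TTheory GRing.Theory Num.Theory numFieldNormedType.Exports.

Local Open Scope classical_set_scope.
Local Open Scope ring_scope.

(* MathComp-Analysis attaches its topology to abstract numeric fields only;
   packing R[i] as a numClosedFieldType gives C the topology of its modulus. *)
Definition complexF (R : realType) : numClosedFieldType := R[i].

(* The bracket is a mere binary operation on V here: none of the notions below
   uses its values outside the subspace under consideration. *)
Section LieAlgebra.
Variables (K : fieldType) (V : lmodType K) (br : V -> V -> V).
Implicit Types A L S I Rad : set V.

Definition lspan A : set V :=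
  [set v | exists n (a : 'I_n -> K) (u : 'I_n -> V),
    (forall i, A (u i)) /\ v = \sum_i a i *: u i].

Definition finite_dimensional A : Prop :=
  exists n (u : 'I_n -> V), A = lspan (range u).

Definition lie_subalgebra A : Prop :=
  submod_closed [in A] /\ forall x y, A x -> A y -> A (br x y).

Definition lie_ideal L I : Prop :=
  [/\ submod_closed [in I], I `<=` L
    & forall x y, L x -> I y -> I (br x y)].

Definition lie_derived A : set V := lspan [set br x y | x in A & y in A].

Definition lie_solvable A : Prop :=
  exists n, iter n lie_derived A = [set 0].

Definition solvable_radical L Rad : Prop :=
  [/\ lie_ideal L Rad, lie_solvable Rad
    & forall I, lie_ideal L I -> lie_solvable I -> I `<=` Rad].

Definition lie_semisimple S : Prop :=
  finite_dimensional S /\ solvable_radical S [set 0].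

Definition levi_decomposition L S Rad : Prop :=
  [/\ lie_subalgebra S /\ lie_semisimple S, solvable_radical L Rad,
      S `&` Rad = [set 0] & L = [set s + r | s in S & r in Rad]].

Definition proper_levi_decomposition L S Rad : Prop :=
  [/\ levi_decomposition L S Rad, S <> [set 0] & Rad <> [set 0]].

End LieAlgebra.

Definition lie_isomorphic (K : fieldType) (V W : lmodType K)
    (brV : V -> V -> V) (brW : W -> W -> W) (A : set V) (B : set W) : Prop :=
  exists phi : V -> W,
    [/\ set_bij A B phi,
        forall (a : K) x y, A x -> A y -> phi (a *: x + y) = a *: phi x + phi y
      & forall x y, A x -> A y -> phi (brV x y) = brW (phi x) (phi y)].

Definition mx_commutator (K : fieldType) n (A B : 'M[K]_n) : 'M[K]_n :=
  A *m B - B *m A.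

Definition sl (n : nat) (K : fieldType) : set 'M[K]_n := [set A | \tr A = 0].
Arguments sl : clear implicits.

Section VectorFields.
Variable K : numFieldType.
Implicit Types (f : 'rV[K]_2 -> K) (V W : 'rV[K]_2 -> 'rV[K]_2).
Implicit Types (U : set 'rV[K]_2) (p x : 'rV[K]_2).

(* Sum of a double power series on a polydisc around p: the bound on the
   partial sums of absolute values is absolute convergence, so that summing
   along squares is immaterial. *)
Definition analytic_at f p : Prop :=
  exists (c : nat -> nat -> K) (r : K), 0 < r /\
    forall h : 'rV[K]_2, `|h| < r ->
      (exists M : K, forall N : nat,
         \sum_(j < N) \sum_(k < N) `|c j k * h 0 0 ^+ j * h 0 1 ^+ k| <= M) /\
      (fun N : nat => \sum_(j < N) \sum_(k < N)
         c j k * h 0 0 ^+ j * h 0 1 ^+ k) @ \oo --> f (p + h).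

Definition analytic_on U f : Prop := forall p, U p -> analytic_at f p.

Definition pderiv (i : 'I_2) f : 'rV[K]_2 -> K :=
  fun x => 'D_(delta_mx 0 i) f x.

(* A vector field on U is encoded by its row of coefficients, extended by 0
   outside U; equality of functions is then equality of vector fields on U. *)
Definition analytic_vfield U : set ('rV[K]_2 -> 'rV[K]_2) :=
  [set V | (forall i, analytic_on U (fun x => V x 0 i)) /\
           (forall x, ~ U x -> V x = 0)].

Definition vf_act V f : 'rV[K]_2 -> K :=
  fun x => \sum_i V x 0 i * pderiv i f x.

Definition coordf (i : 'I_2) : 'rV[K]_2 -> K := fun x => x 0 i.

(* The i-th coefficient of a vector field is its value on the i-th coordinate
   function, so the bracket f |-> V (W f) - W (V f) has these coefficients;
   see vf_bracketE. *)
Definition vf_bracket U V W : 'rV[K]_2 -> 'rV[K]_2 := fun x =>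
  if x \in U then
    \row_i (vf_act V (vf_act W (coordf i)) x - vf_act W (vf_act V (coordf i)) x)
  else 0.

Lemma pderiv_coordf i j x : pderiv i (coordf j) x = (i == j)%:R.
Proof.
apply: cvg_lim => //.
apply: (@cvg_trans _ (cst ((i == j)%:R : K) @ 0^')); last exact: cvg_cst.
apply: near_eq_cvg.
near=> h; rewrite /coordf /= !mxE eqxx /= eq_sym addrK scalerA mulVf ?scale1r //.
by near: h; exact: nbhs_dnbhs_neq.
Unshelve. all: by end_near. Qed.

Lemma vf_act_coordf V i : vf_act V (coordf i) = fun x => V x 0 i.
Proof.
apply/funext => x; rewrite /vf_act (bigD1 i) //= pderiv_coordf eqxx mulr1.
by rewrite big1 ?addr0 // => j ji; rewrite pderiv_coordf (negbTE ji) mulr0.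
Qed.

Lemma pderiv_vf_act V f i x :
  (forall j : 'I_2, derivable (fun y => V y 0 j) x (delta_mx 0 i)) ->
  (forall j : 'I_2, derivable (pderiv j f) x (delta_mx 0 i)) ->
  pderiv i (vf_act V f) x =
  \sum_j (V x 0 j * pderiv i (pderiv j f) x
          + pderiv j f x * pderiv i (fun y => V y 0 j) x).
Proof.
move=> dV df; rewrite {1}/pderiv.
pose g (j : 'I_2) : 'rV[K]_2 -> K := (fun y => V y 0 j) * pderiv j f.
have -> : vf_act V f = \sum_j g j by apply/funext => y; rewrite fct_sumE.
have dg j : derivable (g j) x (delta_mx 0 i) by apply: derivableM.
rewrite derive_sum //; apply: eq_bigr => j _.
by rewrite /g (deriveM (dV j) (df j)).
Qed.

(* The mixed partials of an analytic f commute, so this is the usual formula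
   for the action of the bracket. *)
Lemma vf_bracketE U V W f x : U x ->
  (forall i j : 'I_2,
     [/\ derivable (fun y => V y 0 j) x (delta_mx 0 i),
         derivable (fun y => W y 0 j) x (delta_mx 0 i),
         derivable (pderiv j f) x (delta_mx 0 i)
       & pderiv i (pderiv j f) x = pderiv j (pderiv i f) x]) ->
  vf_act (vf_bracket U V W) f x =
  vf_act V (vf_act W f) x - vf_act W (vf_act V f) x.
Proof.
move=> Ux H.
have EV i : pderiv i (vf_act V f) x = _ :=
  pderiv_vf_act (fun j => let: And4 d _ _ _ := H i j in d)
                (fun j => let: And4 _ _ d _ := H i j in d).
have EW i : pderiv i (vf_act W f) x = _ :=
  pderiv_vf_act (fun j => let: And4 _ d _ _ := H i j in d)
                (fun j => let: And4 _ _ d _ := H i j in d).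
have dC i j : pderiv i (pderiv j f) x = pderiv j (pderiv i f) x.
  by case: (H i j).
pose v i := V x 0 i; pose w i := W x 0 i; pose d i := pderiv i f x.
pose dv i j := pderiv i (fun y => V y 0 j) x.
pose dw i j := pderiv i (fun y => W y 0 j) x.
pose dd i j := pderiv i (pderiv j f) x.
have EB i : vf_bracket U V W x 0 i =
    \sum_k v k * dw k i - \sum_k w k * dv k i.
  by rewrite /vf_bracket mem_set // mxE !vf_act_coordf.
transitivity (\sum_i v i * (\sum_j (w j * dd i j + d j * dw i j)) -
              \sum_i w i * (\sum_j (v j * dd i j + d j * dv i j))); last first.
  by congr (_ - _); apply: eq_bigr => i _; rewrite ?EW ?EV.
transitivity (\sum_i (\sum_k v k * dw k i - \sum_k w k * dv k i) * d i).
  by apply: eq_bigr => i _; rewrite EB.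
have {dC} : forall i j, dd i j = dd j i by exact: dC.
move: dd dw dv d w v {EB} => dd dw dv d w v dC.
have S2 F : \sum_(k < 2) F k = F ord0 + F (lift ord0 ord0) :> K.
  by rewrite !big_ord_recl big_ord0 addr0.
rewrite !S2 {S2} (dC ord0 (lift ord0 ord0)).
generalize (lift ord0 ord0 : 'I_2) (ord0 : 'I_2) => i j.
ring.
Qed.

End VectorFields.

(* Main.v *)
Require Import Defs.
From HB Require Import structures.
From mathcomp Require Import all_boot all_order all_algebra.
From mathcomp Require Import complex.
From mathcomp Require Import all_classical all_reals all_analysis.
From mathcomp Require Import ring zify.
Import Order.TTheory GRing.Theory Num.Theory numFieldNormedType.Exports.
Local Open Scope classical_set_scope.
Local Open Scope ring_scope.

(** Let A be the last nonzero term of the derived series of the radical, an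
    abelian ideal of L.  If two elements X, Y of A are independent at a point q,
    they form a commuting frame whose centralizer is the span of X and Y over
    the constants; S acts on this plane, the elements acting by scalars form a
    central ideal, and the traceless part of the action embeds S into sl2.
    Otherwise A consists of multiples of one field X by first integrals of X.
    The elements of S tangent to X form a solvable ideal, hence vanish, so S
    contains some Y transverse to X at a point q, and s = f X + g Y |-> g
    identifies S with a space G of first integrals of X with bracket
    g h' - h g', where ' is the derivative along Y.  If g has order n > 2 along Y
    at q then g g'' - g'^2 has order 2n - 2 > n, so finite dimension forces
    every nonzero g to have order at most 2; hence 2-jets at q embed G into a
    3-dimensional space, and G is shown to be a copy of sl2.  In both cases the
    embedding is onto because S is not spanned by two elements.
    All this is carried out on Taylor jets at q; jets are faithful by the
    identity theorem, U being connected. *)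

(** Jets replace the passage to smaller neighbourhoods and straightened coordinates: they form a
    commutative ring with two commuting derivations, in which every element of nonzero value is
    invertible. Two fields independent at [q] are therefore a frame over this ring, with
    coefficients given by Cramer's rule, and no flow box is needed. The first integrals of [X] are
    the kernel of a derivation, on which [Y] acts because [X, Y] is a multiple of [X]. Analysis
    enters chiefly through the Taylor map, which has to respect sums, products and partial
    derivatives and to be injective on fields. The point cannot be fixed beforehand: independence is
    tested at all points and [q] is chosen where it holds, so the algebra is stated for a family of
    representations indexed by points. The field [Y] is not normalised either, so that G may look
    like the span of 1, t, t^2 or like that of 1, sinh, cosh; one constant tells these apart. *)

Set Implicit Arguments.
Unset Strict Implicit.
Unset Printing Implicit Defensive.

(** * Jets of functions of two variables *)

Section Jets.
Variable K : fieldType.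

(* A jet is the double sequence of the iterated partial derivatives of a
   function at a point, without division by factorials. *)
Definition jet : Type := nat -> nat -> K.

HB.instance Definition _ := GRing.Zmodule.copy jet (nat -> nat -> K).

Implicit Types f g h : jet.

Definition dx f : jet := fun i j => f i.+1 j.
Definition dy f : jet := fun i j => f i j.+1.
Definition eps f : K := f 0%N 0%N.
Definition jcst (c : K) : jet := fun i j => if (i, j) is (0%N, 0%N) then c else 0.

(* The recursion makes the Leibniz rule hold by construction. *)
Fixpoint jmul0 j f g : K :=
  if j is j'.+1 then jmul0 j' (dy f) g + jmul0 j' f (dy g) else eps f * eps g.
Fixpoint jmul_rec i j f g : K :=
  if i is i'.+1 then jmul_rec i' j (dx f) g + jmul_rec i' j f (dx g)
  else jmul0 j f g.
Definition jmul f g : jet := fun i j => jmul_rec i j f g.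

Lemma jetP f g : (forall i j, f i j = g i j) -> f = g.
Proof. by move=> fg; apply/funext => i; apply/funext => j. Qed.

Lemma jaddE f g i j : (f + g) i j = f i j + g i j. Proof. by []. Qed.
Lemma joppE f i j : (- f) i j = - f i j. Proof. by []. Qed.
Lemma jzeroE i j : (0 : jet) i j = 0. Proof. by []. Qed.

Lemma dxD f g : dx (f + g) = dx f + dx g. Proof. by []. Qed.
Lemma dyD f g : dy (f + g) = dy f + dy g. Proof. by []. Qed.
Lemma dxN f : dx (- f) = - dx f. Proof. by []. Qed.
Lemma dyN f : dy (- f) = - dy f. Proof. by []. Qed.
Lemma dx0 : dx 0 = 0. Proof. by []. Qed.
Lemma dy0 : dy 0 = 0. Proof. by []. Qed.
Lemma dxC f : dy (dx f) = dx (dy f). Proof. by []. Qed.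

Lemma jmul_dx f g : dx (jmul f g) = jmul (dx f) g + jmul f (dx g).
Proof. by []. Qed.

(** The product recursion descends in the x-index before the y-index, so the Leibniz rule for [dx]
    is definitional, while this one needs an induction on the x-index. *)
Lemma jmul_dy f g : dy (jmul f g) = jmul (dy f) g + jmul f (dy g).
Proof.
apply: jetP => i; elim: i f g => [|i IH] f g j //=.
rewrite -[LHS]/(dy (dx (jmul f g)) i j) jmul_dx dyD jaddE !IH.
rewrite -[RHS]/(dx (jmul (dy f) g + jmul f (dy g)) i j) dxD !jmul_dx !jaddE.
by rewrite addrACA.
Qed.

(** Coinduction for jets: it is often easier to name a class of jets stable under both derivations
    than to compute every coefficient of one jet. *)
Lemma jet_bisim (P : jet -> Prop) :
  (forall f, P f -> eps f = 0) -> (forall f, P f -> P (dx f) /\ P (dy f)) ->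
  forall f, P f -> f = 0.
Proof.
move=> P0 PD f Pf; apply: jetP => i j; rewrite jzeroE.
elim: i f Pf => [|i IH] f Pf; last by have [] := PD _ Pf => /IH.
by elim: j f Pf => [|j IH] f Pf; [exact: P0 | have [_] := PD _ Pf => /IH].
Qed.

Lemma jmulC : commutative jmul.
Proof.
move=> f g; apply: jetP => i j.
elim: i j f g => [|i IH] j f g; last first.
  rewrite -![_ i.+1 j]/(dx _ i j) !jmul_dx !jaddE addrC.
  by congr (_ + _); rewrite IH.
elim: j f g => [|j IH] f g; first by rewrite /jmul /= mulrC.
rewrite -![_ _ j.+1]/(dy _ 0%N j) !jmul_dy !jaddE addrC.
by congr (_ + _); rewrite IH.
Qed.

Lemma jmulDl : left_distributive jmul +%R.
Proof.
move=> f g h; apply: jetP => i j; rewrite jaddE.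
elim: i j f g h => [|i IH] j f g h; last first.
  rewrite -![_ i.+1 j]/(dx _ i j) !jmul_dx dxD !jaddE !IH.
  by rewrite addrACA.
elim: j f g h => [|j IH] f g h; first by rewrite /jmul /= mulrDl.
rewrite -![_ _ j.+1]/(dy _ 0%N j) !jmul_dy dyD !jaddE !IH.
by rewrite addrACA.
Qed.

Lemma jmulDr : right_distributive jmul +%R.
Proof. by move=> f g h; rewrite jmulC jmulDl !(jmulC f). Qed.

Lemma jmulA : associative jmul.
Proof.
move=> f g h; apply: jetP => i j.
elim: i j f g h => [|i IH] j f g h; last first.
  rewrite -![_ i.+1 j]/(dx _ i j) !jmul_dx jmulDl jmulDr !jaddE !IH.
  by rewrite addrA.
elim: j f g h => [|j IH] f g h; first by rewrite /jmul /= /eps /= mulrA.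
rewrite -![_ _ j.+1]/(dy _ 0%N j) !jmul_dy jmulDl jmulDr !jaddE !IH.
by rewrite addrA.
Qed.

Lemma dx_jcst c : dx (jcst c) = 0. Proof. by []. Qed.
Lemma dy_jcst c : dy (jcst c) = 0.
Proof. by apply: jetP => -[|i] j. Qed.

Lemma jmul0f f : jmul 0 f = 0.
Proof. by apply: (@addIr _ (jmul 0 f)); rewrite add0r -jmulDl add0r. Qed.

Lemma jmul_cst c f i j : jmul (jcst c) f i j = c * f i j.
Proof.
elim: i j f => [|i IH] j f; last first.
  rewrite -[LHS]/(dx _ i j) jmul_dx dx_jcst jmul0f add0r.
  by rewrite IH.
elim: j f => [|j IH] f //.
by rewrite -[LHS]/(dy _ 0%N j) jmul_dy dy_jcst jmul0f add0r IH.
Qed.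

Lemma jmul1 : left_id (jcst 1) jmul.
Proof. by move=> f; apply: jetP => i j; rewrite jmul_cst mul1r. Qed.

Lemma jone_neq0 : jcst 1 != 0.
Proof. by apply/eqP => /(congr1 eps) /eqP; rewrite /eps /= oner_eq0. Qed.

HB.instance Definition _ := GRing.Zmodule_isComNzRing.Build jet
  jmulA jmulC jmul1 jmulDl jone_neq0.

Lemma joneE : (1 : jet) = jcst 1. Proof. by []. Qed.

Lemma dxM f g : dx (f * g) = dx f * g + f * dx g.
Proof. exact: jmul_dx. Qed.
Lemma dyM f g : dy (f * g) = dy f * g + f * dy g.
Proof. exact: jmul_dy. Qed.
Lemma epsM f g : eps (f * g) = eps f * eps g. Proof. by []. Qed.
Lemma epsD f g : eps (f + g) = eps f + eps g. Proof. by []. Qed.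
Lemma epsN f : eps (- f) = - eps f. Proof. by []. Qed.
Lemma eps_jcst c : eps (jcst c) = c. Proof. by []. Qed.
Lemma eps1 : eps 1 = 1. Proof. by []. Qed.

Lemma jcst_eq f : dx f = 0 -> dy f = 0 -> f = jcst (eps f).
Proof.
move=> fx fy; apply: jetP => -[|i] j; last exact: (congr1 (fun g : jet => g i j) fx).
by case: j => [|j] //; exact: (congr1 (fun g : jet => g 0%N j) fy).
Qed.

Lemma jcstN c : jcst (- c) = - jcst c.
Proof. by apply: jetP => -[|i] [|j] //; rewrite joppE /= oppr0. Qed.

Definition jord n f := forall i j, (i + j < n)%N -> f i j = 0.

Lemma jordM a b f g : jord a f -> jord b g -> jord (a + b) (f * g).
Proof.
have dxo n h : jord n h -> jord n.-1 (dx h) by move=> nh i j ij; apply: nh; lia.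
have dyo n h : jord n h -> jord n.-1 (dy h) by move=> nh i j ij; apply: nh; lia.
move=> fa gb i j; elim: i j a b f g fa gb => [|i IH] j a b f g fa gb ij; last first.
  rewrite -[LHS]/(dx _ i j) dxM jaddE (IH j a.-1 b) ?(IH j a b.-1) ?addr0 //; try exact: dxo; lia.
elim: j a b f g fa gb ij => [|j IH] a b f g fa gb ij; last first.
  rewrite -[LHS]/(dy _ 0%N j) dyM jaddE (IH a.-1 b) ?(IH a b.-1) ?addr0 //; try exact: dyo; lia.
rewrite -[LHS]/(eps _) epsM /eps.
have [a0|a0] := posnP a; last by rewrite (fa 0%N 0%N) ?mul0r //; lia.
by rewrite (gb 0%N 0%N) ?mulr0 //; lia.
Qed.

Lemma jordX n f : eps f = 0 -> jord n (f ^+ n).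
Proof.
move=> f0; elim: n => [|n IH]; first by move=> i j.
rewrite exprS -add1n; apply: jordM => // i j ij.
by have [-> ->] : i = 0%N /\ j = 0%N by lia.
Qed.

(* Geometric series in the maximal ideal. *)
Lemma jet_inv f : eps f != 0 -> exists w, f * w = 1.
Proof.
move=> f0; pose m := 1 - jcst (eps f)^-1 * f.
have m0 : eps m = 0 by rewrite epsD epsN epsM !eps_jcst mulVf // subrr.
pose G n := \sum_(k < n.+1) m ^+ k.
(* The coefficient (i, j) is read off the partial sum up to exponent i + j; all later powers of [m]
   vanish to higher order. *)
pose g : jet := fun i j => G (i + j)%N i j.
have GS n : G n.+1 = G n + m ^+ n.+1 by rewrite /G big_ord_recr.
have GE n n' i j : (i + j <= n)%N -> (n <= n')%N -> G n' i j = G n i j.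
  move=> ijn nn'; rewrite -(subnK nn'); elim: (_ - _)%N => // k IHk.
  by rewrite addSn GS jaddE IHk (jordX m0) ?addr0 //; lia.
have gG n : jord n.+1 (g - G n).
  by move=> i j ij; rewrite jaddE joppE /g [G n i j](@GE (i + j)%N) // subrr.
exists (jcst (eps f)^-1 * g).
have -> : f * (jcst (eps f)^-1 * g) = (1 - m) * g by rewrite /m; ring.
apply: jetP => i j; pose n := (i + j)%N.
have -> : (1 - m) * g = (1 - m) * (g - G n) + (1 - m ^+ n.+1).
  have -> : 1 - m ^+ n.+1 = (1 - m) * G n
    by rewrite -opprB subrX1 -mulNr opprB.
  by ring.
have Z : ((1 - m) * (g - G n)) i j = 0 by apply: (@jordM 0 n.+1).
rewrite jaddE Z add0r.
by rewrite jaddE joppE (jordX m0) ?subr0 // /n.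
Qed.

End Jets.

(** * Lie algebras inside a vector space *)

Section Subspaces.
Variables (K : fieldType) (V : lmodType K).
Implicit Types A B : set V.

Lemma submodP A : submod_closed [in A] <->
  A 0 /\ forall a x y, A x -> A y -> A (a *: x + y).
Proof.
split=> [[A0 AL]|[A0 AL]].
  split=> [|a x y Ax Ay]; first by have := A0; rewrite inE.
  by have := AL a x y; rewrite !inE; apply.
by split=> [|a x y]; rewrite !inE //; apply: AL.
Qed.

Lemma submod_sum A n (a : 'I_n -> K) (u : 'I_n -> V) : submod_closed [in A] ->
  (forall i, A (u i)) -> A (\sum_i a i *: u i).
Proof.
move=> /submodP[A0 AL] Au.
by elim/big_rec: _ => // i x _ Ax; apply: AL.
Qed.

Lemma submodZ A a x : submod_closed [in A] -> A x -> A (a *: x).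
Proof. by move=> /submodP[A0 AL] Ax; rewrite -[_ *: _]addr0; apply: AL. Qed.

Lemma submodD A x y : submod_closed [in A] -> A x -> A y -> A (x + y).
Proof. by move=> /submodP[A0 AL] Ax Ay; rewrite -[x]scale1r; apply: AL. Qed.

Lemma submodB A x y : submod_closed [in A] -> A x -> A y -> A (x - y).
Proof.
by move=> /submodP[A0 AL] Ax Ay; rewrite addrC -scaleN1r; apply: AL.
Qed.

Lemma lspan_min A B : submod_closed [in B] -> A `<=` B -> lspan A `<=` B.
Proof.
by move=> sB AB _ [n [a [u [Au ->]]]]; apply: submod_sum => // i; apply: AB.
Qed.

Lemma sub_lspan A : A `<=` lspan A.
Proof.
move=> x Ax; exists 1%N, (fun=> 1), (fun=> x); split=> //.
by rewrite big_ord1 scale1r.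
Qed.

Lemma lspan_submod A : submod_closed [in lspan A].
Proof.
apply/submodP; split.
  by exists 0%N, (fun=> 0), (fun=> 0); split=> [[]|]; rewrite ?big_ord0.
move=> c _ _ [m [a [u [Au ->]]]] [n [b [v [Av ->]]]].
exists (m + n)%N, (fun i : 'I_(m + n) => match fintype.split i with inl j => c * a j | inr k => b k end),
  (fun i : 'I_(m + n) => match fintype.split i with inl j => u j | inr k => v k end); split.
  by move=> i; case: (fintype.split i).
rewrite big_split_ord /= scaler_sumr; congr (_ + _); apply: eq_bigr => i _.
  by rewrite (unsplitK (inl _ i)) scalerA.
by rewrite (unsplitK (inr _ i)).
Qed.

Lemma finite_dimensional_range A : finite_dimensional A ->
  exists n (u : 'I_n -> V), (forall i, A (u i)) /\
    forall x, A x -> exists a : 'I_n -> K, x = \sum_i a i *: u i.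
Proof.
move=> [n [u ->]]; exists n, u; split=> [i|x]; first by apply: sub_lspan; exists i.
have : lspan (range u) `<=` [set x | exists a : 'I_n -> K, x = \sum_i a i *: u i].
  apply: lspan_min => [|_ [i _ <-]]; first (apply/submodP; split).
  - by exists (fun=> 0); rewrite big1 // => i _; rewrite scale0r.
  - move=> c _ _ [a ->] [b ->]; exists (fun i => c * a i + b i).
    rewrite scaler_sumr -big_split /=; apply: eq_bigr => i _.
    by rewrite scalerDl scalerA.
  exists (fun j => (j == i)%:R); rewrite (bigD1 i) //= eqxx scale1r big1 ?addr0 //.
  by move=> j /negbTE ->; rewrite scale0r.
by apply.
Qed.

Definition linear_on (W : lmodType K) A (l : V -> W) :=
  forall a x y, A x -> A y -> l (a *: x + y) = a *: l x + l y.

Section LinearOn.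
Variables (W : lmodType K) (A : set V) (l : V -> W).
Hypotheses (sA : submod_closed [in A]) (lA : linear_on A l).

Lemma linear_on0 : l 0 = 0.
Proof.
have [A0 _] := (submodP A).1 sA.
by have := lA (-1) A0 A0; rewrite !scaleN1r !addNr.
Qed.

Lemma linear_onZ a x : A x -> l (a *: x) = a *: l x.
Proof.
have [A0 _] := (submodP A).1 sA.
by move=> Ax; have := lA a Ax A0; rewrite linear_on0 !addr0.
Qed.

Lemma linear_onD x y : A x -> A y -> l (x + y) = l x + l y.
Proof. by move=> Ax Ay; have := lA 1 Ax Ay; rewrite !scale1r. Qed.

Lemma linear_onB x y : A x -> A y -> l (x - y) = l x - l y.
Proof. by move=> Ax Ay; rewrite addrC -scaleN1r lA // scaleN1r addrC. Qed.

Lemma linear_on_sum n (a : 'I_n -> K) (u : 'I_n -> V) : (forall i, A (u i)) ->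
  l (\sum_i a i *: u i) = \sum_i a i *: l (u i).
Proof.
move=> Au; elim: n a u Au => [|n IH] a u Au; first by rewrite !big_ord0 linear_on0.
rewrite !big_ord_recl lA // ?IH //.
by apply: submod_sum => // i; apply: Au.
Qed.

End LinearOn.

(** The matrix of the values of n + 1 of the functionals on n + 1 of the vectors is triangular with
    nonzero diagonal, yet it factors through the coordinates on n generators of [A], so its rank is
    at most n. *)
Lemma no_triangular_functionals A (l : nat -> V -> K) (s : nat -> V) (d : nat -> nat) :
  finite_dimensional A -> submod_closed [in A] ->
  (forall n, linear_on A (l n : V -> K^o)) -> (forall k, A (s k)) ->
  (forall i j, (i < j)%N -> l (d i) (s j) = 0) -> (forall k, l (d k) (s k) != 0) ->
  False.
Proof.
move=> /finite_dimensional_range[n [u [Au uA]]] sA lA As tri dg.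
pose J : 'M[K]_n.+1 := \matrix_(i, j) l (d j) (s i).
have detJ : \det J != 0.
  rewrite -det_tr det_trig; last first.
    by apply/is_trig_mxP => i j ij; rewrite !mxE tri.
  by apply/prodf_neq0 => i _; rewrite !mxE.
pose c k := projT1 (cid (uA _ (As k))).
have cE k : s k = \sum_i c k i *: u i := projT2 (cid (uA _ (As k))).
have JE : J = (\matrix_(i < n.+1, j < n) c i j) *m \matrix_(i < n, j < n.+1) l (d j) (u i).
  apply/matrixP => i j; rewrite !mxE cE (linear_on_sum sA (lA _)) //.
  by apply: eq_bigr => k _; rewrite !mxE.
have /mxrank_unit : J \in unitmx by rewrite unitmxE unitfE.
by rewrite JE => E; have := mulmx_max_rank
  (\matrix_(i < n.+1, j < n) c i j) (\matrix_(i < n, j < n.+1) l (d j) (u i)); rewrite E ltnn.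
Qed.

End Subspaces.

Section LieFacts.
Variables (K : fieldType) (V : lmodType K) (br : V -> V -> V).
Implicit Types A B I L S Rad : set V.

(** The axioms are imposed on [L] only: a bracket of vector fields is defined on all of [V] but
    obeys them only where the coefficients are sufficiently differentiable. *)
Definition lie_on L := [/\ lie_subalgebra br L,
  forall z, L z -> linear_on L (br^~ z),
  forall x, L x -> br x x = 0,
  forall x y, L x -> L y -> br x y = - br y x &
  forall x y z, L x -> L y -> L z ->
    br x (br y z) = br (br x y) z + br y (br x z)].

Lemma lie_on_sub L S : lie_on L -> lie_subalgebra br S -> S `<=` L -> lie_on S.
Proof.
move=> [_ l1 l2 l3 l4] sS SL; split=> // *; [|exact/l2/SL|apply: l3|apply: l4]; try exact: SL.
by move=> a x y /SL ? /SL ?; apply: l1 => //; apply: SL.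
Qed.

Lemma lie_on_linear_r L x : lie_on L -> L x -> linear_on L (br x).
Proof.
move=> [[/submodP[_ sL] _] l1 _ l3 _] Lx a y z Ly Lz.
by rewrite l3 ?l1 ?(l3 x) // ?opprD -?scalerN //; apply: sL.
Qed.

Lemma lie_derived_min A B : submod_closed [in B] ->
  (forall x y, A x -> A y -> B (br x y)) -> lie_derived br A `<=` B.
Proof. by move=> sB AB; apply: lspan_min => // _ [x Ax [y Ay <-]]; apply: AB. Qed.

Lemma lie_derived_bracket A x y : A x -> A y -> lie_derived br A (br x y).
Proof. by move=> Ax Ay; apply: sub_lspan; exists x => //; exists y. Qed.

Lemma lie_derived_ideal L I : lie_on L -> lie_ideal br L I ->
  lie_ideal br L (lie_derived br I) /\ lie_derived br I `<=` I.
Proof.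
move=> lL [sI IL LI].
have dI : lie_derived br I `<=` I.
  by apply: lie_derived_min => // x y Ix Iy; apply: LI => //; apply: IL.
split=> //; split; [exact: lspan_submod|by move=> x /dI /IL|].
move=> x y Lx [n [a [u [Iu ->]]]].
have [[sL cL] _ _ _ jac] := lL.
have Lu i : L (u i) by case: (Iu i) => x' /IL Lx' [y' /IL Ly' <-]; apply: cL.
rewrite (linear_on_sum sL (lie_on_linear_r lL Lx)) //.
apply: submod_sum; first exact: lspan_submod.
move=> i; case: (Iu i) => x' Ix' [y' Iy' <-].
rewrite jac //; try exact: IL.
by apply: submodD; [exact: lspan_submod|apply: lie_derived_bracket..] => //; apply: LI.
Qed.

Lemma last_derived L Rad : lie_on L -> lie_ideal br L Rad -> lie_solvable br Rad ->
  Rad <> [set 0] -> exists A, [/\ lie_ideal br L A, A `<=` Rad, A <> [set 0] &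
    forall x y, A x -> A y -> br x y = 0].
Proof.
move=> lL iR [n]; elim: n Rad iR => [|n IH] Rad iR; first by [].
rewrite iterSr => sR R0.
have [iD DR] := lie_derived_ideal lL iR.
have [D0|D0] := pselect (lie_derived br Rad = [set 0]); last first.
  have [A [iA AD A0 AA]] := IH _ iD sR D0.
  by exists A; split=> //; apply: subset_trans AD DR.
exists Rad; split=> // x y Rx Ry.
by have := lie_derived_bracket Rx Ry; rewrite D0.
Qed.

(** A certificate for solvability in two steps that avoids computing derived algebras: [B] is any
    subspace that catches the brackets of [A] and has zero brackets itself. *)
Lemma lie_solvable2 A B : submod_closed [in B] -> A 0 -> B 0 ->
  (forall x y, A x -> A y -> B (br x y)) ->
  (forall x y, B x -> B y -> br x y = 0) -> lie_solvable br A.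
Proof.
move=> sB A0 B0 AB BB; exists 2%N; apply/seteqP; split=> /= [|_ ->]; last first.
  by have [h _] := (submodP _).1 (@lspan_submod _ _ [set br x y | x in lie_derived br A & y in lie_derived br A]).
have s0 : submod_closed [in [set 0 : V]].
  by apply/submodP; split=> // a x y /= -> ->; rewrite scaler0 addr0.
have dB : lie_derived br A `<=` B by apply: lie_derived_min.
by apply: lie_derived_min => // x y /dB Bx /dB By; apply: BB.
Qed.

Lemma semisimple_ideal S I : lie_semisimple br S -> lie_ideal br S I ->
  lie_solvable br I -> I `<=` [set 0].
Proof. by move=> [_ [_ _ h]]; apply: h. Qed.

(** By bilinearity and alternation every bracket is a multiple of [u, v], so the derived algebra is
    at most a line. Then [S] is a solvable ideal of itself. *)
Lemma semisimple_not_span2 S (u v : V) : lie_on S -> lie_semisimple br S -> S <> [set 0] ->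
  S u -> S v -> (forall s, S s -> exists a b, s = a *: u + b *: v) -> False.
Proof.
move=> lS ssS S0 Su Sv span; apply: S0.
have [[sS cS] l1 l2 l3 _] := lS.
have [S0 SL] := (submodP S).1 sS.
apply/seteqP; split=> [|_ ->] //.
apply: (semisimple_ideal ssS); first by split.
pose w := br u v.
apply: (@lie_solvable2 _ [set x | exists c, x = c *: w]) => //.
- apply/submodP; split; first by exists 0; rewrite scale0r.
  by move=> a _ _ [c ->] [d ->]; exists (a * c + d); rewrite scalerDl scalerA.
- by exists 0; rewrite scale0r.
- move=> x y /span[a [b ->]] /span[c [d ->]].
  have lr x (Sx : S x) := lie_on_linear_r lS Sx.
  exists (a * d - b * c).
  have SZ := fun a x => @submodZ _ _ S a x sS.
  have SD := fun x y => @submodD _ _ S x y sS.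
  have El z : S z -> br (a *: u + b *: v) z = a *: br u z + b *: br v z.
    by move=> Sz; rewrite (l1 z Sz) ?(linear_onZ sS (l1 z Sz)) //; apply: SZ.
  have Er z : S z -> br z (c *: u + d *: v) = c *: br z u + d *: br z v.
    by move=> Sz; rewrite (lr z Sz) ?(linear_onZ sS (lr z Sz)) //; apply: SZ.
  rewrite El ?Er //; last by apply: SD; apply: SZ.
  rewrite !l2 // (l3 v u) // !scaler0 add0r addr0 !scalerN !scalerA -scaleNr -scalerDl.
  by rewrite -/w.
move=> _ _ [c ->] [d ->].
have Sw : S w by apply: cS.
rewrite (linear_onZ sS (l1 _ _)) ?(linear_onZ sS (lie_on_linear_r lS _)) //; try exact: submodZ.
by rewrite l2 // !scaler0.
Qed.

(** If the image had dimension at most 2, injectivity would let two elements span [S], which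
    [semisimple_not_span2] excludes; so the image is the whole space. *)
Lemma semisimple_onto3 S (l : V -> 'rV[K]_3) : lie_on S -> lie_semisimple br S ->
  S <> [set 0] -> linear_on S l -> (forall s, S s -> l s = 0 -> s = 0) ->
  forall w, exists2 s, S s & l s = w.
Proof.
move=> lS ssS S0 lin inj.
have [[sS cS] _ _ _ _] := lS.
have [n [u [Su uS]]] := finite_dimensional_range ssS.1.
pose B := \matrix_(i < n) l (u i).
have lB (x : 'rV_n) : l (\sum_i x 0 i *: u i) = x *m B.
  rewrite (linear_on_sum sS lin) // mulmx_sum_row.
  by apply: eq_bigr => i _; rewrite rowK.
have im m (C : 'M[K]_(m, n)) i : exists2 s, S s & l s = row i (C *m B).
  exists (\sum_j row i C 0 j *: u j); first exact: submod_sum.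
  by rewrite lB row_mul.
have [fB|nfB] := boolP (row_full B).
  move=> w; exists (\sum_j (w *m pinvmx B) 0 j *: u j); first exact: submod_sum.
  by rewrite lB mulmxKpV // submx_full.
exfalso; have r2 : (\rank B <= 2)%N.
  by have := rank_leq_col B; move: nfB; rewrite /row_full; lia.
(* The row basis of [B] is padded with zero rows, so that exactly two rows span the image whether
   its rank is 0, 1 or 2. *)
pose C : 'M[K]_(2, 3) := pid_mx (\rank B) *m row_base B.
have BC : (B <= C)%MS.
  have : (row_base B <= C)%MS.
    apply/submxP; exists (pid_mx (\rank B)).
    by rewrite /C mulmxA pid_mx_id // pid_mx_1 mul1mx.
  by rewrite eq_row_base.
have CB : (C <= B)%MS by rewrite (submx_trans (submxMl _ _)) // eq_row_base.
have /submxP[E CE] := CB; have /submxP[D BD] := BC.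
have [v0 Sv0 v0E] := im _ E ord0.
have [v1 Sv1 v1E] := im _ E (lift ord0 ord0).
apply: (semisimple_not_span2 lS ssS S0 Sv0 Sv1) => s Ss.
have [a sE] := uS _ Ss.
pose y := (\row_i a i) *m D.
exists (y 0 ord0), (y 0 (lift ord0 ord0)).
apply/eqP; rewrite -subr_eq0; apply/eqP; apply: inj.
  by apply: submodB => //; apply: submodD => //; apply: submodZ.
rewrite (linear_onB lin) ?(linear_onD lin) ?(linear_onZ sS lin) //;
  try by [apply: submodZ|apply: submodD => //; apply: submodZ].
have -> : l s = y *m C.
  rewrite -mulmxA -BD -lB sE; congr l; apply: eq_bigr => i _.
  by rewrite mxE.
rewrite v0E v1E -CE mulmx_sum_row !big_ord_recl big_ord0 addr0.
by rewrite subrr.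
Qed.

(** An injective homomorphism is enough: three entries determine a traceless matrix, and
    [semisimple_onto3] applied to these entries gives surjectivity. *)
Lemma sl2_isomorphic S (psi : V -> 'M[K]_2) : lie_on S -> lie_semisimple br S ->
  S <> [set 0] -> linear_on S psi -> (forall s, S s -> psi s = 0 -> s = 0) ->
  (forall s, S s -> \tr (psi s) = 0) ->
  (forall s t, S s -> S t -> psi (br s t) = mx_commutator (psi s) (psi t)) ->
  lie_isomorphic br (@mx_commutator K 2) S (sl 2 K).
Proof.
move=> lS ssS S0 lin inj tr0 hom; exists psi; split=> //.
have [[sS cS] _ _ _ _] := lS.
pose i0 : 'I_2 := ord0; pose i1 : 'I_2 := lift ord0 ord0.
pose l (M : 'M[K]_2) : 'rV[K]_3 := \row_i [:: M i0 i0; M i0 i1; M i1 i0]`_i.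
have trE M : \tr M = M i0 i0 + M i1 i1.
  by rewrite /mxtrace !big_ord_recl big_ord0 addr0.
have lP M N : \tr M = 0 -> \tr N = 0 -> l M = l N -> M = N.
  rewrite !trE => /eqP; rewrite addrC addr_eq0 => /eqP M1 /eqP.
  rewrite addrC addr_eq0 => /eqP N1 /rowP E.
  have := E ord0; have := E (lift ord0 ord0); have := E (lift ord0 (lift ord0 ord0)).
  rewrite !mxE /= => E2 E1 E0; apply/matrixP => i j.
  have [-> | ->] : i = i0 \/ i = i1 by case: i => [[|[|//]] ?]; [left|right]; apply: val_inj.
    by have [-> | ->] : j = i0 \/ j = i1 by case: j => [[|[|//]] ?]; [left|right]; apply: val_inj.
  have [-> | ->] : j = i0 \/ j = i1 by case: j => [[|[|//]] ?]; [left|right]; apply: val_inj.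
  - by [].
  - by rewrite M1 N1 E0.
have l0 : l 0 = 0 by apply/rowP => -[[|[|[|//]]] ?]; rewrite !mxE.
have linl : linear_on S (l \o psi).
  move=> a x y Sx Sy; rewrite /= lin //.
  by apply/rowP => -[[|[|[|//]]] ?]; rewrite !mxE.
split.
- by move=> s Ss; apply: tr0.
- move=> s t; rewrite !inE => Ss St E.
  apply/eqP; rewrite -subr_eq0; apply/eqP/inj; first exact: submodB.
  by rewrite (linear_onB lin) // E subrr.
- move=> M /= M0.
  have linj s : S s -> (l \o psi) s = 0 -> s = 0.
    by move=> Ss /= E; apply: inj => //; apply: lP; rewrite ?tr0 ?mxtrace0 ?l0.
  have [s Ss sM] := semisimple_onto3 lS ssS S0 linl linj (l M).
  by exists s => //; apply: lP => //; apply: tr0.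
Qed.

End LieFacts.

(** * Vector fields with jet coefficients *)

Section JetFields.
Variable K : fieldType.
Notation J := (jet K).
Implicit Types (f g h : J) (X Y Z W : J * J).

Definition act X f : J := X.1 * dx f + X.2 * dy f.
Definition fbr X Y : J * J := (act X Y.1 - act Y X.1, act X Y.2 - act Y X.2).
Definition fdet X Y : J := X.1 * Y.2 - X.2 * Y.1.
Definition fcomb f X g Y : J * J := (f * X.1 + g * Y.1, f * X.2 + g * Y.2).

Lemma actD X f g : act X (f + g) = act X f + act X g.
Proof. by rewrite /act dxD dyD; ring. Qed.
Lemma actN X f : act X (- f) = - act X f.
Proof. by rewrite /act dxN dyN; ring. Qed.
Lemma actB X f g : act X (f - g) = act X f - act X g.
Proof. by rewrite actD actN. Qed.
Lemma actM X f g : act X (f * g) = act X f * g + f * act X g.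
Proof. by rewrite /act dxM dyM; ring. Qed.
Lemma act_jcst X c : act X (jcst c) = 0.
Proof. by rewrite /act dx_jcst dy_jcst; ring. Qed.
Lemma act0 X : act X 0 = 0.
Proof. by rewrite /act dx0 dy0; ring. Qed.
Lemma act_fcomb f X g Y h : act (fcomb f X g Y) h = f * act X h + g * act Y h.
Proof. by rewrite /act /=; ring. Qed.

Lemma act_fbr X Y f : act (fbr X Y) f = act X (act Y f) - act Y (act X f).
Proof. by rewrite /act /= /act !(dxD, dyD, dxM, dyM) dxC; ring. Qed.

Lemma fbrC X Y : fbr X Y = fcomb (-1) (fbr Y X) 0 X.
Proof. by rewrite /fbr /fcomb /=; congr pair; ring. Qed.

Lemma fbrXX X : fbr X X = (0, 0).
Proof. by rewrite /fbr !subrr. Qed.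

Lemma fbr_fcomb_r X f Y g Z : fbr X (fcomb f Y g Z) =
  (act X f * Y.1 + act X g * Z.1 + f * (fbr X Y).1 + g * (fbr X Z).1,
   act X f * Y.2 + act X g * Z.2 + f * (fbr X Y).2 + g * (fbr X Z).2).
Proof.
by rewrite /fbr !act_fcomb /= !actD !actM; congr pair; ring.
Qed.

Lemma fbr_fcomb_l Z f X g Y : fbr (fcomb f X g Y) Z =
  (- act Z f * X.1 - act Z g * Y.1 + f * (fbr X Z).1 + g * (fbr Y Z).1,
   - act Z f * X.2 - act Z g * Y.2 + f * (fbr X Z).2 + g * (fbr Y Z).2).
Proof.
by rewrite /fbr !act_fcomb /= !actD !actM; congr pair; ring.
Qed.

Lemma fbr_jacobi X Y Z :
  fbr X (fbr Y Z) = fcomb 1 (fbr (fbr X Y) Z) 1 (fbr Y (fbr X Z)).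
Proof.
rewrite /fcomb [LHS]/fbr [fbr (fbr X Y) Z]/fbr [fbr Y (fbr X Z)]/fbr /=.
by rewrite !act_fbr !actB; congr pair; ring.
Qed.

Section Frame.
Variables (X Y : J * J) (w : J).
Hypothesis XYw : fdet X Y * w = 1.

(** Cramer's rule: [cX] and [cY] are the coefficients in the frame [X], [Y], with [w] the inverse of
    its determinant. *)
Definition cX Z := fdet Z Y * w.
Definition cY Z := fdet X Z * w.

Lemma frameE Z : Z = fcomb (cX Z) X (cY Z) Y.
Proof.
case: Z => z1 z2; rewrite /fcomb /cX /cY; move: XYw; rewrite /fdet /= => XY1.
by congr pair; [rewrite -[z1 in LHS]mulr1 -XY1|rewrite -[z2 in LHS]mulr1 -XY1]; ring.
Qed.

Lemma frame_cX f g : cX (fcomb f X g Y) = f.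
Proof.
by rewrite /cX -[RHS]mulr1 -XYw /fdet /=; ring.
Qed.

Lemma frame_cY f g : cY (fcomb f X g Y) = g.
Proof.
by rewrite /cY -[RHS]mulr1 -XYw /fdet /=; ring.
Qed.

Lemma cX_Y : cX Y = 0. Proof. by rewrite /cX /fdet; ring. Qed.
Lemma cY_X : cY X = 0. Proof. by rewrite /cY /fdet; ring. Qed.
Lemma cX_0 : cX (0, 0) = 0. Proof. by rewrite /cX /fdet /=; ring. Qed.
Lemma cY_0 : cY (0, 0) = 0. Proof. by rewrite /cY /fdet /=; ring. Qed.

Lemma cX_comb c Z W : cX (fcomb (jcst c) Z 1 W) = jcst c * cX Z + cX W.
Proof. by rewrite /cX /fdet /=; ring. Qed.

Lemma cY_comb c Z W : cY (fcomb (jcst c) Z 1 W) = jcst c * cY Z + cY W.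
Proof. by rewrite /cY /fdet /=; ring. Qed.

Lemma act_frame_eq0 f : act X f = 0 -> act Y f = 0 -> dx f = 0 /\ dy f = 0.
Proof.
move=> Xf Yf; split.
  transitivity ((Y.2 * act X f - X.2 * act Y f) * w); last by rewrite Xf Yf; ring.
  by rewrite -[LHS]mulr1 -XYw /fdet /act; ring.
transitivity ((X.1 * act Y f - Y.1 * act X f) * w); last by rewrite Xf Yf; ring.
by rewrite -[LHS]mulr1 -XYw /fdet /act; ring.
Qed.

(** When X and Y commute, [X, fX + gY] = X(f) X + X(g) Y, and likewise for Y. The coefficients of
    [Z] are thus killed by both fields of the frame, hence by [dx] and [dy], and are constants. *)
Lemma centralizer_frame Z : fbr X Y = (0, 0) -> fbr X Z = (0, 0) -> fbr Y Z = (0, 0) ->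
  Z = fcomb (jcst (eps (cX Z))) X (jcst (eps (cY Z))) Y.
Proof.
move=> XY XZ YZ.
have YX : fbr Y X = (0, 0) by rewrite fbrC XY /fcomb /=; congr pair; ring.
have EX : fbr X Z = fcomb (act X (cX Z)) X (act X (cY Z)) Y.
  by rewrite {1}(frameE Z) fbr_fcomb_r fbrXX XY /fcomb /=; congr pair; ring.
have EY : fbr Y Z = fcomb (act Y (cX Z)) X (act Y (cY Z)) Y.
  by rewrite {1}(frameE Z) fbr_fcomb_r fbrXX YX /fcomb /=; congr pair; ring.
have [f1 f2] : dx (cX Z) = 0 /\ dy (cX Z) = 0.
  by apply: act_frame_eq0; [rewrite -(frame_cX (act X (cX Z)) (act X (cY Z))) -EX XZ ?cX_0 ?cY_0|
    rewrite -(frame_cX (act Y (cX Z)) (act Y (cY Z))) -EY YZ ?cX_0 ?cY_0].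
have [g1 g2] : dx (cY Z) = 0 /\ dy (cY Z) = 0.
  by apply: act_frame_eq0; [rewrite -(frame_cY (act X (cX Z)) (act X (cY Z))) -EX XZ ?cX_0 ?cY_0|
    rewrite -(frame_cY (act Y (cX Z)) (act Y (cY Z))) -EY YZ ?cX_0 ?cY_0].
by rewrite -(jcst_eq f1 f2) -(jcst_eq g1 g2) -frameE.
Qed.

(** The hypothesis says that [X, Y] is a multiple of X; modulo X, the bracket [X, fX + gY] then
    reduces to X(g) Y. *)
Lemma transverse_act Z : cY (fbr X Y) = 0 -> cY (fbr X Z) = act X (cY Z).
Proof.
move=> XY.
rewrite {1}(frameE Z) fbr_fcomb_r fbrXX.
set f := cX Z; set g := cY Z; set a := cX (fbr X Y).
have -> : fbr X Y = fcomb a X 0 Y by rewrite {1}(frameE (fbr X Y)) XY.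
rewrite -[RHS](frame_cY (act X f + g * a)); congr cY.
by rewrite /fcomb /=; congr pair; ring.
Qed.

Lemma parallel_act Z : cY Z = 0 -> cX (fbr X Z) = act X (cX Z).
Proof.
move=> Z0; rewrite {1}(frameE Z) fbr_fcomb_r fbrXX Z0 act0.
rewrite -[RHS](frame_cX _ 0); congr cX.
by rewrite /fcomb /=; congr pair; ring.
Qed.

Lemma parallel_fbr Z W : cY Z = 0 -> cY W = 0 ->
  fbr Z W = fcomb (cX Z * act X (cX W) - cX W * act X (cX Z)) X 0 Y.
Proof.
move=> Z0 W0; rewrite {1}(frameE Z) {1}(frameE W) Z0 W0.
set f := cX Z; set g := cX W.
rewrite fbr_fcomb_r !act_fcomb !fbr_fcomb_l fbrXX act0 /fcomb /=.
by congr pair; ring.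
Qed.

(** Modulo X, fields whose transverse coefficient is a first integral behave like fields g d/dt on
    the space of leaves, with Y in the role of d/dt. *)
Lemma transverse_fbr Z W : cY (fbr X Y) = 0 ->
  act X (cY Z) = 0 -> act X (cY W) = 0 ->
  cY (fbr Z W) = cY Z * act Y (cY W) - cY W * act Y (cY Z).
Proof.
move=> XY XZ XW; rewrite {1}(frameE Z) {1}(frameE W).
have YX : fbr Y X = fcomb (- cX (fbr X Y)) X 0 Y.
  by rewrite fbrC {1}(frameE (fbr X Y)) XY /fcomb /=; congr pair; ring.
move: XZ XW; set f := cX Z; set g := cY Z; set f' := cX W; set g' := cY W => Xg Xg'.
rewrite fbr_fcomb_r !fbr_fcomb_l !fbrXX !act_fcomb Xg Xg' YX.
set a := cX (fbr X Y).
have -> : fbr X Y = fcomb a X 0 Y by rewrite {1}(frameE (fbr X Y)) XY.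
rewrite -[RHS](frame_cY (f * act X f' - f' * act X f + g * act Y f' - g' * act Y f
   + (f * g' - g * f') * a)); congr cY.
by rewrite /fcomb /=; congr pair; ring.
Qed.

(** With [X, Y] = aX one gets X(Y f) = Y(X f) + a X(f), so Y is a derivation of the ring of first
    integrals. *)
Lemma act_stable f : cY (fbr X Y) = 0 -> act X f = 0 -> act X (act Y f) = 0.
Proof.
move=> XY Xf; have := act_fbr X Y f; rewrite Xf act0 subr0 => <-.
by rewrite (frameE (fbr X Y)) XY act_fcomb Xf; ring.
Qed.

Local Notation D := (act Y).

Lemma iter_actD n f g : iter n D (f + g) = iter n D f + iter n D g.
Proof. by elim: n => //= n ->; rewrite actD. Qed.

Lemma iter_actN n f : iter n D (- f) = - iter n D f.
Proof. by elim: n => //= n ->; rewrite actN. Qed.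

Lemma iter_act_cst n c f : iter n D (jcst c * f) = jcst c * iter n D f.
Proof. by elim: n => //= n ->; rewrite actM act_jcst mul0r add0r. Qed.

Lemma iter_act0 n : iter n D 0 = 0.
Proof. by elim: n => //= n ->; rewrite act0. Qed.

(** A first integral depends only on the transverse direction. Formally, the ideal generated by the
    iterated Y-derivatives of [f] is stable under [dx] and [dy], and all its elements have value
    0. *)
Lemma first_integral_eq0 f : cY (fbr X Y) = 0 -> act X f = 0 ->
  (forall n, eps (iter n D f) = 0) -> f = 0.
Proof.
move=> XY Xf f0.
pose P h := exists (m : nat) (a : 'I_m -> J) (k : 'I_m -> nat),
  h = \sum_i a i * iter (k i) D f.
have Xn n : act X (iter n D f) = 0 by elim: n => //= n; apply: act_stable.
have PD (d : J -> J) (u : J) : d 0 = 0 -> (forall g h, d (g + h) = d g + d h) ->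
   (forall g h, d (g * h) = d g * h + g * d h) ->
   (forall n, d (iter n D f) = u * iter n.+1 D f) -> forall h, P h -> P (d h).
  move=> d0 dD dM dn h [m [a [k ->]]].
  exists (m + m)%N, (fun i => match fintype.split i with inl i => d (a i) | inr i => a i * u end),
    (fun i => match fintype.split i with inl i => k i | inr i => (k i).+1 end).
  rewrite (big_morph d dD d0) big_split_ord /= -big_split /=; apply: eq_bigr => i _.
  by rewrite (unsplitK (inl _ i)) (unsplitK (inr _ i)) dM dn mulrA.
apply: (@jet_bisim _ P); last by exists 1%N, (fun=> 1), (fun=> 0%N); rewrite big_ord1 mul1r.
  move=> h [m [a [k ->]]]; rewrite (big_morph (@eps K) (@epsD K) (erefl : eps 0 = 0)).
  by rewrite big1 // => i _; rewrite epsM f0 mulr0.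
(* Solving the frame equations for a function killed by X gives dx = - X.2 w Y and dy = X.1 w Y on
   it. *)
move=> h Ph; split; [apply: (PD (@dx K) (- X.2 * w))|apply: (PD (@dy K) (X.1 * w))] => //.
- move=> n; rewrite -[LHS]mulr1 -XYw.
  transitivity ((Y.2 * act X (iter n D f) - X.2 * iter n.+1 D f) * w); first by rewrite /fdet /= /act; ring.
  by rewrite Xn; ring.
- exact: dyM.
- move=> n; rewrite -[LHS]mulr1 -XYw.
  transitivity ((X.1 * iter n.+1 D f - Y.1 * act X (iter n D f)) * w); first by rewrite /fdet /= /act; ring.
  by rewrite Xn; ring.
Qed.

Definition dord a f := forall i, (i < a)%N -> eps (iter i D f) = 0.

Lemma dord_act a f : dord a f -> dord a.-1 (D f).
Proof. by move=> fa i ia; rewrite -iterSr; apply: fa; lia. Qed.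

Lemma dordM a b f g : dord a f -> dord b g -> dord (a + b) (f * g).
Proof.
move=> fa gb i; elim: i a b f g fa gb => [|i IH] a b f g fa gb ab.
  rewrite /= epsM; have [a0|a0] := posnP a; last by rewrite (fa 0%N) ?mul0r.
  by rewrite (gb 0%N) ?mulr0 //; lia.
rewrite iterSr actM iter_actD epsD (IH a.-1 b) ?(IH a b.-1) ?addr0 //; try exact: dord_act; lia.
Qed.

(** In the Leibniz expansion of order a + b only the term with [a] derivatives on [f] and [b] on [g]
    survives; the induction is Pascal's rule. *)
Lemma dord_leadM a b f g : dord a f -> dord b g ->
  eps (iter (a + b) D (f * g)) =
  'C(a + b, a)%:R * (eps (iter a D f) * eps (iter b D g)).
Proof.
have [n nE] := ubnP (a + b)%N.
elim: n a b f g nE => // n IH [|a] [|b] f g nE fa gb.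
- by rewrite /= epsM bin0 mul1r.
- rewrite add0n iterSr actM iter_actD epsD (@dordM 0 b.+1) ?add0r //.
  by have := IH 0%N b f (D g); rewrite add0n !bin0 -iterSr; apply=> //; exact: (dord_act gb).
- rewrite addn0 iterSr actM iter_actD epsD (@dordM a.+1 0 f (D g)) ?addr0 ?addn0 //.
  by have := IH a 0%N (D f) g; rewrite addn0 !binn -iterSr; apply=> //; [lia|exact: (dord_act fa)].
rewrite addSn iterSr actM iter_actD epsD.
have := IH a b.+1 (D f) g; rewrite -iterSr => -> //; [|exact: (dord_act fa)].
have := IH a.+1 b f (D g); rewrite -iterSr addSn -addnS => -> //; [|exact: (dord_act gb)].
by rewrite binS natrD; ring.
Qed.

End Frame.
End JetFields.

(** * The two cases *)

Section Mx2.
Variable K : fieldType.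

Definition mx2 (a b c d : K) : 'M[K]_2 :=
  \matrix_(i, j) if i == ord0 then if j == ord0 then a else b
                 else if j == ord0 then c else d.

Lemma ord2P (i : 'I_2) : i = ord0 \/ i = lift ord0 ord0.
Proof. by case: i => [[|[|//]] ?]; [left|right]; apply: val_inj. Qed.

Lemma mx2_inj a b c d a' b' c' d' : mx2 a b c d = mx2 a' b' c' d' ->
  [/\ a = a', b = b', c = c' & d = d'].
Proof.
move=> /matrixP E; split; [have := E ord0 ord0|have := E ord0 (lift ord0 ord0)|
  have := E (lift ord0 ord0) ord0|have := E (lift ord0 ord0) (lift ord0 ord0)];
  by rewrite !mxE.
Qed.

Lemma tr_mx2 a b c d : \tr (mx2 a b c d) = a + d.
Proof. by rewrite /mxtrace !big_ord_recl big_ord0 addr0 !mxE. Qed.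

Lemma mx2_comb k a b c d a' b' c' d' : k *: mx2 a b c d + mx2 a' b' c' d' =
  mx2 (k * a + a') (k * b + b') (k * c + c') (k * d + d').
Proof.
by apply/matrixP => i j; rewrite !mxE; case: ifP => _; case: ifP.
Qed.

Lemma mx2_commutator a b c d a' b' c' d' :
  mx_commutator (mx2 a b c d) (mx2 a' b' c' d') =
  mx2 (b * c' - b' * c) (a * b' + b * d' - (a' * b + b' * d))
      (c * a' + d * c' - (c' * a + d' * c)) (c * b' - c' * b).
Proof.
apply/matrixP => i j; rewrite !mxE !big_ord_recl !big_ord0 !mxE /=.
by case: (ord2P i) => ->; case: (ord2P j) => -> /=; ring.
Qed.

Lemma mx2_0 : mx2 0 0 0 0 = 0.
Proof. by apply/matrixP => i j; rewrite !mxE; case: ifP => _; case: ifP. Qed.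

End Mx2.

(** * Lie algebras represented faithfully by jet fields at every point of [Q] *)

Section Representation.
Variables (K : numFieldType) (V : lmodType K) (br : V -> V -> V) (L : set V).
Variables (Q : Type) (rho : Q -> V -> jet K * jet K).
Hypotheses (sL : lie_subalgebra br L)
  (rho_lin : forall q a x y, L x -> L y ->
     rho q (a *: x + y) = fcomb (jcst a) (rho q x) 1 (rho q y))
  (rho_br : forall q x y, L x -> L y -> rho q (br x y) = fbr (rho q x) (rho q y))
  (rho_inj : forall q x, L x -> rho q x = (0, 0) -> x = 0).

Lemma rho0 q : rho q 0 = (0, 0).
Proof.
have [L0 _] := (submodP _).1 sL.1.
have := rho_lin q (-1) L0 L0; rewrite scaleN1r addNr => ->.
by rewrite jcstN -joneE /fcomb /=; congr pair; ring.
Qed.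

Lemma rho_eq q x y : L x -> L y -> rho q x = rho q y -> x = y.
Proof.
have [L0 LL] := (submodP _).1 sL.1.
move=> Lx Ly E; apply/eqP; rewrite -subr_eq0 addrC -scaleN1r; apply/eqP.
apply: (@rho_inj q); first exact: LL.
by rewrite rho_lin // E jcstN -joneE /fcomb /=; congr pair; ring.
Qed.

(** Each axiom is pulled back along the injective [rho q] from the jet fields at a single point,
    whence the argument in [Q]. *)
Lemma rho_lie : Q -> lie_on br L.
Proof.
move=> q.
have [sub cL] := sL; have [L0 LL] := (submodP _).1 sub.
have Lopp x : L x -> L (- x) by move=> Lx; rewrite -[- x]addr0 -scaleN1r; apply: LL.
have rhoN x : L x -> rho q (- x) = fcomb (-1) (rho q x) 0 (0, 0).
  move=> Lx; rewrite -[- x]addr0 -scaleN1r rho_lin // rho0 jcstN -joneE.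
  by rewrite /fcomb /=; congr pair; ring.
split=> //.
- move=> z Lz a x y Lx Ly; apply: (@rho_eq q); [by apply: cL => //; apply: LL|by apply: LL; apply: cL|].
  rewrite rho_br ?rho_lin ?rho_br //; try by [apply: LL|apply: cL].
  rewrite fbr_fcomb_l act_jcst joneE act_jcst /fcomb /=.
  by congr pair; ring.
- move=> x Lx; apply: (@rho_inj q); first exact: cL.
  by rewrite rho_br // fbrXX.
- move=> x y Lx Ly; apply: (@rho_eq q); [exact: cL|by apply/Lopp/cL|].
  rewrite rho_br // rhoN ?rho_br //; last exact: cL.
  by rewrite fbrC /fcomb /=; congr pair; ring.
move=> x y z Lx Ly Lz.
have L1 : L (br (br x y) z) by apply: (cL) => //; apply: cL.
have L2 : L (br y (br x z)) by apply: (cL) => //; apply: cL.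
apply: (@rho_eq q); [by apply: (cL) => //; apply: cL|exact: submodD|].
rewrite -[br (br x y) z]scale1r rho_lin //.
rewrite !rho_br //; try by apply: cL.
by rewrite fbr_jacobi.
Qed.

Section Cases.
Variables (S A : set V) (q : Q).
Hypotheses (SL : S `<=` L) (lS : lie_on br S) (ssS : lie_semisimple br S)
  (S0 : S <> [set 0]) (iA : lie_ideal br L A)
  (AA : forall x y, A x -> A y -> br x y = 0).

Let AL : A `<=` L. Proof. by case: iA. Qed.
Let lL : lie_on br L := rho_lie q.
Let cL x y : L x -> L y -> L (br x y). Proof. by case: sL => _; apply. Qed.
Let cS x y : S x -> S y -> S (br x y). Proof. by case: lS => -[_ + _ _ _ _]; apply. Qed.
Let LA x y : L x -> A y -> A (br x y). Proof. by case: iA => _ _; apply. Qed.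
Let AL' x y : A x -> L y -> A (br x y).
Proof.
move=> Ax Ly; have [_ _ _ anti _] := lL.
rewrite anti //; last exact: AL.
by rewrite -scaleN1r; apply: submodZ; [case: iA|apply: LA].
Qed.

(* The elements acting on a commuting frame by scalars form a central ideal of
   the semisimple part. *)
Lemma rank2_case X Y : (S `&` A) `<=` [set 0] -> A X -> A Y ->
  eps (fdet (rho q X) (rho q Y)) != 0 ->
  lie_isomorphic br (@mx_commutator K 2) S (sl 2 K).
Proof.
move=> SA AX AY /jet_inv[w XYw].
have LX := AL AX; have LY := AL AY.
set x := rho q X in XYw; set y := rho q Y in XYw.
pose a z := eps (cX y w (rho q z)); pose b z := eps (cY x w (rho q z)).
have aL c z t : L z -> L t -> a (c *: z + t) = c * a z + a t.
  by move=> Lz Lt; rewrite /a rho_lin // cX_comb epsD epsM eps_jcst.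
have bL c z t : L z -> L t -> b (c *: z + t) = c * b z + b t.
  by move=> Lz Lt; rewrite /b rho_lin // cY_comb epsD epsM eps_jcst.
have [[subL _] brl _ anti jac] := lL.
have [_ LL] := (submodP _).1 subL.
have fxy : fbr x y = (0, 0) by rewrite -rho_br // AA // rho0.
have cent z : L z -> br X z = 0 -> br Y z = 0 -> z = a z *: X + b z *: Y.
  move=> Lz Xz Yz; apply: (@rho_eq q) => //; first by apply: LL => //; apply: submodZ.
  have bY : rho q (b z *: Y) = fcomb (jcst (b z)) y 0 y.
    rewrite -[_ *: _]addr0 rho_lin ?rho0 //; last exact: ((submodP _).1 subL).1.
    by rewrite /fcomb /=; congr pair; ring.
  rewrite rho_lin // ?bY; last exact: submodZ.
  rewrite {1}(centralizer_frame XYw fxy (_ : fbr x (rho q z) = _) (_ : fbr y (rho q z) = _)).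
  - by rewrite /fcomb /=; congr pair; ring.
  - by rewrite -rho_br // Xz rho0.
  - by rewrite -rho_br // Yz rho0.
have Acomb z : A z -> z = a z *: X + b z *: Y by move=> Az; apply: cent; rewrite ?AA //; apply: AL.
pose m11 s := a (br s X); pose m21 s := b (br s X).
pose m12 s := a (br s Y); pose m22 s := b (br s Y).
have brX s : L s -> br s X = m11 s *: X + m21 s *: Y by move=> Ls; apply/Acomb/LA.
have brY s : L s -> br s Y = m12 s *: X + m22 s *: Y by move=> Ls; apply/Acomb/LA.
have lin1 (m : V -> K) (c : V -> K) Z : L Z ->
    (forall c0 z t, L z -> L t -> c (c0 *: z + t) = c0 * c z + c t) ->
    forall k s t, L s -> L t -> c (br (k *: s + t) Z) = k * c (br s Z) + c (br t Z).
  by move=> LZ cl k s t Ls Lt; rewrite brl // cl //; apply: cL.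
have aXY k l : a (k *: X + l *: Y) = k.
  rewrite aL //; last exact: submodZ.
  have := aL l Y 0 LY ((submodP _).1 subL).1; rewrite addr0 => ->.
  rewrite {1}/a [cX _ _ _]XYw eps1 /a cX_Y rho0 cX_0.
  by ring.
have bXY k l : b (k *: X + l *: Y) = l.
  rewrite bL //; last exact: submodZ.
  have := bL l Y 0 LY ((submodP _).1 subL).1; rewrite addr0 => ->.
  rewrite {1}/b cY_X /b [cY _ _ (rho q Y)]XYw eps1 rho0 cY_0.
  by ring.
have lr s (Ls : L s) := lie_on_linear_r lL Ls.
have brst s k l : L s -> br s (k *: X + l *: Y) = k *: br s X + l *: br s Y.
  by move=> Ls; rewrite (lr s Ls) ?(linear_onZ subL (lr s Ls)) //; apply: submodZ.
have com2 s t Z : L s -> L t -> L Z -> br (br s t) Z = br s (br t Z) - br t (br s Z).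
  by move=> Ls Lt LZ; rewrite jac // addrK.
have combB k l k' l' : k *: X + l *: Y - (k' *: X + l' *: Y) = (k - k') *: X + (l - l') *: Y.
  by rewrite opprD addrACA -!scalerBl.
have combL k l k' l' c d : c *: (k *: X + l *: Y) + d *: (k' *: X + l' *: Y) = (c * k + d * k') *: X + (c * l + d * l') *: Y.
  by rewrite !scalerDr !scalerA addrACA -!scalerDl.
have homs s t : L s -> L t ->
    mx2 (m11 (br s t)) (m12 (br s t)) (m21 (br s t)) (m22 (br s t)) =
    mx_commutator (mx2 (m11 s) (m12 s) (m21 s) (m22 s)) (mx2 (m11 t) (m12 t) (m21 t) (m22 t)).
  move=> Ls Lt; rewrite mx2_commutator.
  have EX : br (br s t) X = br s (m11 t *: X + m21 t *: Y) - br t (m11 s *: X + m21 s *: Y).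
    by rewrite com2 // -!brX.
  have EY : br (br s t) Y = br s (m12 t *: X + m22 t *: Y) - br t (m12 s *: X + m22 s *: Y).
    by rewrite com2 // -!brY.
  rewrite !brst // (brX s) // (brX t) // (brY s) // (brY t) // !combL !combB in EX EY.
  rewrite [m11 (br s t)](congr1 a EX) [m21 (br s t)](congr1 b EX).
  rewrite [m12 (br s t)](congr1 a EY) [m22 (br s t)](congr1 b EY) !aXY !bXY.
  by congr mx2; ring.
have h2 : (2%:R : K) != 0 by rewrite pnatr_eq0.
have ker0 s0 : S s0 -> m11 s0 = m22 s0 -> m12 s0 = 0 -> m21 s0 = 0 -> s0 = 0.
  pose I := [set s | [/\ S s, m11 s = m22 s, m12 s = 0 & m21 s = 0]].
  have [[sS _] _ _ _ _] := lS; have [S00 SS] := (submodP _).1 sS.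
  (* A scalar matrix commutes with every matrix, so [s, t] acts by zero on the plane. It then
     centralizes the frame, is a constant combination of [X] and [Y], and lies in both [S] and
     [A]. *)
  have cI s t : S s -> I t -> br s t = 0.
    move=> Ss [St e1 e2 e3]; have Ls := SL Ss; have Lt := SL St.
    have Lst : L (br s t) by apply: cL.
    have := homs s t Ls Lt; rewrite mx2_commutator e2 e3 -e1 => /mx2_inj[E1 E2 E3 E4].
    have F1 : m11 (br s t) = 0 by rewrite E1; ring.
    have F2 : m12 (br s t) = 0 by rewrite E2; ring.
    have F3 : m21 (br s t) = 0 by rewrite E3; ring.
    have F4 : m22 (br s t) = 0 by rewrite E4; ring.
    apply: SA; split; first exact: cS.
    have Z : br s t = a (br s t) *: X + b (br s t) *: Y.
      apply: cent => //; rewrite anti // ?brX ?brY //.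
        by rewrite F1 F3 !scale0r addr0 oppr0.
      by rewrite F2 F4 !scale0r addr0 oppr0.
    by rewrite Z; apply: submodD; [case: iA|apply: submodZ => //; case: iA..].
  have lin0 (c : V -> K) Z : L Z ->
     (forall c0 z t, L z -> L t -> c (c0 *: z + t) = c0 * c z + c t) -> c (br 0 Z) = 0.
    move=> LZ cl; have L0 := ((submodP _).1 subL).1.
    by have := lin1 a c Z LZ cl (-1) 0 0 L0 L0; rewrite scaleN1r addNr mulN1r addNr.
  have II : lie_ideal br S I.
    split.
    - apply/submodP; split; first by rewrite /I /= /m11 /m12 /m21 /m22 !lin0.
      move=> k s' t' [Ss e1 e2 e3] [St f1 f2 f3]; split; first exact: SS.
      + by rewrite /m11 /m22 !lin1 //; try exact: SL; congr (_ * _ + _).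
      + by rewrite /m12 lin1 //; try exact: SL; rewrite -/(m12 _) -/(m12 _) e2 f2 mulr0 addr0.
      + by rewrite /m21 lin1 //; try exact: SL; rewrite -/(m21 _) -/(m21 _) e3 f3 mulr0 addr0.
    - by move=> s' [].
    - move=> s' t' Ss It; rewrite (cI _ _ Ss It).
      by rewrite /I /= /m11 /m12 /m21 /m22 !lin0.
  move=> Ss e1 e2 e3; apply: (semisimple_ideal ssS II); last by [].
  apply: (@lie_solvable2 _ _ _ _ [set 0]) => //.
  - by apply/submodP; split=> // k s' t' -> ->; rewrite scaler0 addr0.
  - by case: II => /submodP[].
  - by move=> s' t' [Ss' _ _ _] It; apply: cI.
  - by move=> s' t' -> ->; apply: AA; case: iA => /submodP[].
(* The matrix of [s] minus half its trace; the scalar part does not affect commutators. *)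
pose psi s := mx2 ((m11 s - m22 s) / 2%:R) (m12 s) (m21 s) ((m22 s - m11 s) / 2%:R).
apply: (@sl2_isomorphic _ _ _ _ psi) => //.
- move=> k s t /SL Ls /SL Lt; rewrite /psi mx2_comb /m11 /m22 /m12 /m21 !lin1 //.
  by congr mx2; ring.
- move=> s Ss; rewrite /psi -mx2_0 => /mx2_inj[/eqP].
  rewrite mulf_eq0 invr_eq0 (negbTE h2) orbF subr_eq0 => /eqP e1 e2 e3 _.
  exact: ker0.
- by move=> s Ss; rewrite tr_mx2 -mulrDl addrA subrK subrr mul0r.
- move=> s t /SL Ls /SL Lt; rewrite /psi.
  have := homs s t Ls Lt; rewrite !mx2_commutator => /mx2_inj[-> -> -> ->].
  by congr mx2; field.
Qed.

(* The elements of [S] tangent to the foliation of [X] form a solvable ideal. *)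
Lemma tangent_eq0 X (Y : jet K * jet K) w : A X -> fdet (rho q X) Y * w = 1 ->
  (forall Z, A Z -> cY (rho q X) w (rho q Z) = 0) ->
  forall s, S s -> cY (rho q X) w (rho q s) = 0 -> s = 0.
Proof.
move=> AX XYw tA; set x := rho q X in XYw tA *.
have LX := AL AX; have [[subL _] _ _ _ _] := lL; have [[subS _] _ _ _ _] := lS.
have [L0 LL] := (submodP _).1 subL.
(* For t = fX the bracket [s, t] is s(f) X + f [s, X], and [s, X] lies in [A], whose elements are
   tangent to X. *)
have tI s t : L s -> L t -> cY x w (rho q t) = 0 -> cY x w (rho q (br s t)) = 0.
  move=> Ls Lt t0; rewrite rho_br // (frameE XYw (rho q t)) t0.
  have [_ _ _ anti _] := lL.
  have : cY x w (rho q (br s X)) = 0 by apply/tA/LA.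
  rewrite rho_br // fbr_fcomb_r act0 -/x => sX.
  rewrite (frameE XYw (fbr (rho q s) x)) sX.
  set f := cX _ _ _; set g := cX _ _ _.
  rewrite -[RHS](frame_cY XYw (act (rho q s) f + f * g)); congr cY.
  by rewrite /fcomb /=; congr pair; ring.
pose I := [set s | S s /\ cY x w (rho q s) = 0].
have II : lie_ideal br S I.
  split=> [|s []//|s t Ss [St t0]]; last by split; [exact: cS|by apply: tI => //; apply: SL].
  apply/submodP; split; first by split; [exact: ((submodP _).1 subS).1|rewrite rho0 cY_0].
  move=> c s t [Ss s0] [St t0]; split; first by apply: ((submodP _).1 subS).2.
  by rewrite rho_lin ?cY_comb ?s0 ?t0 ?mulr0 ?addr0 //; apply: SL.
have parl s : L s -> cY x w (rho q s) = 0 -> cX Y w (rho q (br X s)) = act x (cX Y w (rho q s)).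
  by move=> Ls s0; rewrite rho_br // -/x (parallel_act XYw).
(* For s = fX the element [X, s] = X(f) X lies in the abelian ideal [A], so it commutes with X and
   X(X(f)) = 0. *)
have fI s : S s -> cY x w (rho q s) = 0 -> act x (act x (cX Y w (rho q s))) = 0.
  move=> Ss s0; have Ls := SL Ss.
  have AXs : A (br X s) by apply: AL'.
  by rewrite -parl // -parl ?(AA AX AXs) ?rho0 ?cX_0 //; [exact: cL|exact: tA].
move=> s Ss s0; apply: (semisimple_ideal ssS II); last by [].
(* The second term consists of the multiples fX with X(f) = 0, which commute with each other. It
   contains [f1 X, f2 X], since f1 X(f2) - f2 X(f1) is killed by X once X(X(f1)) = X(X(f2)) = 0. *)
apply: (@lie_solvable2 _ _ _ _
  [set z | [/\ L z, cY x w (rho q z) = 0 & act x (cX Y w (rho q z)) = 0]]).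
- apply/submodP; split; first by rewrite /= rho0 cY_0 cX_0 act0.
  move=> c z t [Lz z0 z1] [Lt t0 t1]; split; first exact: LL.
    by rewrite rho_lin // cY_comb z0 t0 mulr0 addr0.
  by rewrite rho_lin // cX_comb actD actM z1 t1 act_jcst mul0r mulr0 !addr0.
- by case: II => /submodP[].
- by rewrite /= rho0 cY_0 cX_0 act0.
- move=> s1 s2 [S1 z1] [S2 z2]; have L1 := SL S1; have L2 := SL S2.
  split; [exact: cL|exact: tI|].
  rewrite rho_br // (parallel_fbr XYw) // (frame_cX XYw).
  move: (fI _ S1 z1) (fI _ S2 z2); move: (cX _ _ _) (cX _ _ _) => f1 f2 F1 F2.
  by rewrite actB !actM F1 F2; ring.
move=> s1 s2 [L1 z1 f1] [L2 z2 f2]; apply: (@rho_inj q); first exact: cL.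
rewrite rho_br // (parallel_fbr XYw) // f1 f2 /fcomb.
by congr pair; ring.
Qed.

(** Taking [Y] inside [S] puts the constant 1 among the transverse coefficients and makes them
    stable under differentiation, because [Y, s] has coefficient g'. *)
Lemma rank1_case X Y : A X -> S Y -> eps (fdet (rho q X) (rho q Y)) != 0 ->
  (forall Z, A Z -> fdet (rho q X) (rho q Z) = 0) ->
  lie_isomorphic br (@mx_commutator K 2) S (sl 2 K).
Proof.
move=> AX SY /jet_inv[w XYw] dA.
have LX := AL AX; have LY := SL SY.
have [[subL _] _ _ antiL _] := lL; have [[subS _] _ _ _ _] := lS.
set x := rho q X in XYw dA; set y := rho q Y in XYw.
have tA Z : A Z -> cY x w (rho q Z) = 0 by move=> AZ; rewrite /cY dA // mul0r.
pose g s := cY x w (rho q s).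
have gL c s t : S s -> S t -> g (c *: s + t) = jcst c * g s + g t.
  by move=> /SL Ls /SL Lt; rewrite /g rho_lin // cY_comb.
have xy : cY x w (fbr x y) = 0 by rewrite -rho_br //; apply/tA/AL'.
have xg s : S s -> act x (g s) = 0.
  by move=> /SL Ls; rewrite -(transverse_act XYw) // -rho_br //; apply/tA/AL'.
have gbr s t : S s -> S t -> g (br s t) = g s * act y (g t) - g t * act y (g s).
  move=> Ss St; rewrite /g rho_br; [|exact: SL..].
  exact: (transverse_fbr XYw xy (xg _ Ss) (xg _ St)).
have gY : g Y = 1 by exact: XYw.
have gYs s : S s -> g (br Y s) = act y (g s).
  by move=> Ss; rewrite gbr // gY joneE act_jcst -joneE; ring.
pose l n s := eps (iter n (act y) (g s)).
have lL' n : linear_on S (l n : V -> K^o).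
  by move=> c s t Ss St; rewrite /l gL // iter_actD iter_act_cst epsD epsM eps_jcst.
have l_inj s : S s -> (forall n, l n s = 0) -> s = 0.
  move=> Ss s0; apply: (tangent_eq0 AX XYw tA Ss).
  exact: (first_integral_eq0 XYw xy (xg _ Ss)).
(* If g has order n = m + 2, then g g'' and g'^2 both have order at least 2n - 2 = 2m + 2. Their
   leading terms differ by the factor C(2n-2, n) - C(2n-2, n-1), and m > 0 makes the new order
   larger. *)
have jump m s : S s -> (0 < m)%N -> dord y m.+2 (g s) -> l m.+2 s != 0 ->
    let t := br s (br Y s) in dord y (m.+1 + m.+1) (g t) /\ l (m.+1 + m.+1)%N t != 0.
  move=> Ss m0 os s0 /=.
  have SYs : S (br Y s) by apply: cS.
  have o1 : dord y m.+1 (act y (g s)) := dord_act os.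
  have o2 : dord y m (act y (act y (g s))) := dord_act o1.
  have E : (m.+2 + m = m.+1 + m.+1)%N by lia.
  have gt : g (br s (br Y s)) = g s * act y (act y (g s)) - act y (g s) * act y (g s).
    by rewrite gbr // gYs.
  split.
    move=> i ij; rewrite gt iter_actD iter_actN epsD epsN.
    by rewrite (dordM os o2) ?(dordM o1 o1) ?subr0 // E.
  rewrite /l gt iter_actD iter_actN epsD epsN -{1}E.
  rewrite (dord_leadM os o2) (dord_leadM o1 o1) -!iterSr E -mulrBl.
  rewrite mulf_neq0 ?mulf_neq0 // subr_eq0 eqr_nat; apply/eqP => CE.
  (* From (m+2) C(2m+2, m+2) = (m+1) C(2m+2, m+1), equality of the two positive binomials would give
     m + 2 = m + 1. *)
  have := mul_bin_left (m.+1 + m.+1) m.+1; rewrite CE addnK => /eqP.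
  by rewrite eqn_mul2r ?gtn_eqF // bin_gt0; lia.
have low s : S s -> l 0%N s = 0 -> l 1%N s = 0 -> l 2%N s = 0 -> s = 0.
  move=> Ss s0 s1 s2; apply: contrapT => sn0.
  (* The number in a pair is the order minus two, which [jump] doubles. Iteration yields elements of
     strictly increasing order, and the derivatives at these orders are triangular on them. *)
  pose good (p : V * nat) := [/\ S p.1, (0 < p.2)%N, dord y p.2.+2 (g p.1) & l p.2.+2 p.1 != 0].
  have [p0 gp0] : exists p, good p.
    have [n ln] : exists n, l n s != 0.
      apply: contrapT => h; apply/sn0/l_inj => // n; apply/eqP/negPn/negP => ln.
      by apply: h; exists n.
    have [k lk kmin] := ex_minnP (ex_intro (fun n => l n s != 0) n ln).
    have k3 : (2 < k)%N by case: k lk {kmin} => [|[|[|k]]] //; rewrite ?s0 ?s1 ?s2 eqxx.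
    case: k lk kmin k3 => [|[|k]] // lk kmin k3.
    exists (s, k); split=> //= i ik.
    by apply/eqP/negPn/negP => /kmin; rewrite leqNgt ik.
  have /choice[f fP] : forall p : V * nat, exists p' : V * nat,
      good p -> good p' /\ (p.2 < p'.2)%N.
    move=> p.
    have [[Sp p1 op lp]|ngp] := pselect (good p); last by exists p.
    have [ot lt] := jump _ _ Sp p1 op lp.
    exists (br p.1 (br Y p.1), (p.2 + p.2)%N) => _; split; last by rewrite /=; lia.
    have E : ((p.2 + p.2).+2 = p.2.+1 + p.2.+1)%N by lia.
    by split; rewrite /= ?E //; [apply: cS => //; apply: cS|lia].
  pose u k := iter k f p0.
  have gu k : good (u k) by elim: k => //= k /fP[].
  have mono i j : (i < j)%N -> ((u i).2 < (u j).2)%N.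
    elim: j => // j IH; rewrite ltnS leq_eqVlt => /orP[/eqP <-|/IH h].
      by have [_] := fP _ (gu i).
    by apply: ltn_trans h _; have [_] := fP _ (gu j).
  apply: (@no_triangular_functionals _ _ S l (fun k => (u k).1) (fun k => (u k).2.+2)) => //.
  - exact: ssS.1.
  - by move=> k; case: (gu k).
  - by move=> i j /mono ij; case: (gu j) => _ _ o _; apply: o; rewrite !ltnS.
  - by move=> k; case: (gu k).
pose jet2 s : 'rV[K]_3 := \row_i l i s.
have jet2E s : jet2 s = 0 -> [/\ l 0%N s = 0, l 1%N s = 0 & l 2%N s = 0].
  move=> /rowP E; have := E ord0; have := E (lift ord0 ord0).
  by have := E (lift ord0 (lift ord0 ord0)); rewrite !mxE.
(* The element [e] has the 2-jet of t^2/2; together with [Y] and [Y, e] it gives a basis of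
   2-jets. *)
have [e Se eE] : exists2 s, S s & jet2 s = \row_i (i == 2%N :> nat)%:R.
  apply: (semisimple_onto3 lS ssS S0).
    by move=> c s t Ss St; apply/rowP => i; rewrite !mxE lL'.
  by move=> s Ss /jet2E[]; apply: low.
have /rowP eE' := eE.
have e0 : l 0%N e = 0 by have := eE' ord0; rewrite !mxE.
have e1 : l 1%N e = 0 by have := eE' (lift ord0 ord0); rewrite !mxE.
have e2 : l 2%N e = 1 by have := eE' (lift ord0 (lift ord0 ord0)); rewrite !mxE.
have SYe : S (br Y e) by apply: cS.
have [_ SS] := (submodP _).1 subS.
(* Only the derivation rules are needed from here on; an abstract [D] keeps the rewriting away from
   the partial derivatives. *)
have [D [aD DM DD DN]] : exists D : jet K -> jet K, [/\ act y = D,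
    forall f h, D (f * h) = D f * h + f * D h,
    forall f h, D (f + h) = D f + D h & forall f, D (- f) = - D f].
  by exists (act y); split=> *; rewrite ?actM ?actD ?actN.
have [E [gE E0 E1 E2 E3]] : exists E, [/\ g e = E, eps E = 0, eps (D E) = 0,
    eps (D (D E)) = 1 & eps (D (D (D E))) = l 3%N e] by exists (g e); rewrite -aD.
(* The 2-jet of [z] vanishes, so [z = 0]; the third derivative of this relation
   yields [l 3 e = 0]. *)
pose z := 1 *: br e (br Y e) + e.
have Sz : S z by apply: SS => //; apply: cS.
have gz : g z = E * D (D E) - D E * D E + E.
  by rewrite -aD /z gL ?(gbr _ _ Se SYe) ?(gYs _ Se) ?gE -?joneE ?mul1r //; apply: cS.
have z0 : z = 0.
  apply: low => //; rewrite /l gz aD /= ?(DD, DN, DM) !(epsD, epsN, epsM) E0 ?E1 ?E2; ring.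
(* With E = E' = 0 and E'' = 1 at the point, the third derivative of E E'' - E'^2 + E is (4 - 6 + 1)
   E'''. *)
have e3 : l 3%N e = 0.
  have : eps (D (D (D (g z)))) = 0 by rewrite z0 /g rho0 cY_0 -aD !act0.
  rewrite gz !(DD, DN, DM) !(epsD, epsN, epsM) E0 E1 E2 E3 => h.
  by apply/eqP; rewrite -oppr_eq0 -h; apply/eqP; ring.
(* In the model, e is t^2/2 when b = 0 and (cosh(ct) - 1)/c^2 with c^2 = b otherwise; in both, every
   g satisfies g''' = b g', which [l3] asserts at the point. *)
pose b := l 4%N e.
have lYs n s : S s -> l n (br Y s) = l n.+1 s by move=> Ss; rewrite /l gYs // iterSr.
have lY0 : l 0%N Y = 1 by rewrite /l gY.
have lYS n : l n.+1 Y = 0.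
  by rewrite /l gY iterSr joneE act_jcst iter_act0.
have l3 s : S s -> l 3%N s = b * l 1%N s.
  move=> Ss; pose t := l 0%N s *: Y + (l 1%N s *: br Y e + l 2%N s *: e).
  have St : S t by do !apply: submodD => //; apply: submodZ.
  have lt n : l n t = l 0%N s * l n Y + (l 1%N s * l n.+1 e + l 2%N s * l n e).
    rewrite /t (lL' n) //; last by apply: submodD => //; apply: submodZ.
    rewrite (lL' n) //; last exact: submodZ.
    by rewrite (linear_onZ subS (lL' n)) // lYs.
  suff -> : l 3%N s = l 3%N t by rewrite lt lYS e3 mulr0 mulr0 /b; ring.
  congr (l 3%N); apply/eqP; rewrite -subr_eq0; apply/eqP.
  by apply: low; rewrite ?(linear_onB (lL' _)) ?lt ?lY0 ?lYS ?e0 ?e1 ?e2 ?e3 //; [exact: submodB|ring..].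
have h2 : (2%:R : K) != 0 by rewrite pnatr_eq0.
(* By [l3], the triple (g, g', g'' - b/2 g) at [q] transforms under the bracket
   g h' - h g' like the entries of a traceless matrix. *)
pose psi s := mx2 (- l 1%N s / 2%:R) (l 0%N s)
  (- (l 2%N s - b / 2%:R * l 0%N s) / 2%:R) (l 1%N s / 2%:R).
apply: (@sl2_isomorphic _ _ _ _ psi) => //.
- move=> c s t Ss St; rewrite /psi mx2_comb !lL' //.
  by congr mx2; rewrite /GRing.scale /=; ring.
- move=> s Ss; rewrite /psi -mx2_0 => /mx2_inj[_ s0 + s1].
  have {}s1 : l 1%N s = 0.
    by move/eqP: s1; rewrite mulf_eq0 invr_eq0 (negbTE h2) orbF => /eqP.
  rewrite s0 mulr0 subr0 => /eqP.
  rewrite mulf_eq0 invr_eq0 (negbTE h2) orbF oppr_eq0 => /eqP s2.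
  exact: low.
- by move=> s Ss; rewrite tr_mx2 mulNr addNr.
- move=> s t Ss St.
  have b0 : l 0%N (br s t) = l 0%N s * l 1%N t - l 0%N t * l 1%N s.
    by rewrite /l gbr // epsD epsN !epsM.
  have b1 : l 1%N (br s t) = l 0%N s * l 2%N t - l 0%N t * l 2%N s.
    rewrite /l gbr // aD /=; move: (g s) (g t) => u v.
    by rewrite !(DD, DN, DM) !(epsD, epsN, epsM); ring.
  have b2 : l 2%N (br s t) = l 1%N s * l 2%N t - l 1%N t * l 2%N s
      + b * (l 0%N s * l 1%N t - l 0%N t * l 1%N s).
    transitivity (l 1%N s * l 2%N t - l 1%N t * l 2%N s
      + (l 0%N s * l 3%N t - l 0%N t * l 3%N s)).
      rewrite /l gbr // aD /=; move: (g s) (g t) => u v.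
      by rewrite !(DD, DN, DM) !(epsD, epsN, epsM); ring.
    by rewrite !l3 //; ring.
  by rewrite /psi mx2_commutator b0 b1 b2; congr mx2; field.
Qed.

End Cases.

Hypotheses
  (rho_pt : forall x, L x -> x <> 0 ->
     exists q, eps (rho q x).1 != 0 \/ eps (rho q x).2 != 0)
  (rho_det : forall x y, L x -> L y ->
     (forall q, eps (fdet (rho q x) (rho q y)) = 0) ->
     forall q, fdet (rho q x) (rho q y) = 0).

(** One of the two cases must occur: if [A] has rank one and no element of [S] is transverse to [X]
    at any point, then [tangent_eq0] makes [S] vanish. *)
Lemma levi_sl2 S Rad : proper_levi_decomposition br L S Rad ->
  lie_isomorphic br (@mx_commutator K 2) S (sl 2 K).
Proof.
move=> [[[sS ssS] [iR sR _] SR LE] S0 R0].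
have Rad0 : Rad 0 by case: iR => /submodP[].
have SL : S `<=` L by move=> s Ss; rewrite LE; exists s => //; exists 0 => //; rewrite addr0.
have nz (B : set V) : submod_closed [in B] -> B <> [set 0] -> exists2 x, B x & x <> 0.
  move=> sB nB; have [B0 _] := (submodP _).1 sB; apply: contrapT => h; apply: nB.
  by apply/seteqP; split=> [x Bx|_ ->//]; apply: contrapT => x0; apply: h; exists x.
have [s1 Ss1 s1n] := nz _ sS.1 S0.
have [q0 _] := rho_pt (SL _ Ss1) s1n.
have lL := rho_lie q0.
have lS := lie_on_sub lL sS SL.
have [A [iA AR A0 AA]] := last_derived lL iR sR R0.
have AL : A `<=` L by case: iA.
have [X AX X0] : exists2 x, A x & x <> 0 by apply: nz => //; case: iA.
have SA : S `&` A `<=` [set 0] by rewrite -SR => s [Ss /AR Rs].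
have [[X' [Y' [q [AX' AY' d]]]]|r1] := pselect (exists X Y q,
    [/\ A X, A Y & eps (fdet (rho q X) (rho q Y)) != 0]).
  exact: (rank2_case SL lS ssS S0 iA AA SA AX' AY' d).
have dA q Z : A Z -> fdet (rho q X) (rho q Z) = 0.
  move=> AZ; apply: rho_det => [||q']; [exact: AL..|].
  by apply/eqP/negPn/negP => d; apply: r1; exists X, Z, q'.
have [[Y [q [SY d]]]|r2] := pselect (exists Y q,
    S Y /\ eps (fdet (rho q X) (rho q Y)) != 0).
  exact: (rank1_case SL lS ssS S0 iA AA AX SY d (dA q)).
exfalso; apply: s1n.
have dS q s : S s -> fdet (rho q X) (rho q s) = 0.
  move=> Ss; apply: rho_det => [||q']; [exact: AL|exact: SL|].
  by apply/eqP/negPn/negP => d; apply: r2; exists s, q'.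
have [q Xq] := rho_pt (AL _ AX) X0.
have [Y dXY] : exists Y, eps (fdet (rho q X) Y) != 0.
  case: Xq => d; [exists (0, 1)|exists (1, 0)]; rewrite /fdet /=.
    by rewrite mulr1 mulr0 subr0.
  by rewrite mulr0 mulr1 sub0r epsN oppr_eq0.
have [w XYw] := jet_inv dXY.
apply: (tangent_eq0 SL lS ssS iA AA AX XYw) => // [Z AZ|].
  by rewrite /cY dA // mul0r.
by rewrite /cY dS // mul0r.
Qed.

End Representation.

(** * Double power series *)

Section Sequences.
Variable K : numFieldType.
Implicit Types (u v : nat -> K) (l m : K).

Definition scvg u l :=
  forall e, 0 < e -> exists N, forall n, (N <= n)%N -> `|u n - l| < e.

Lemma scvgP u l : scvg u l <-> u @ \oo --> l.
Proof.
split=> [ul|/cvgrPdist_lt ul e e0].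
  apply/cvgrPdist_lt => e e0; have [N uN] := ul e e0.
  by exists N => // n /= Nn; rewrite distrC; apply: uN.
by have [N _ uN] := ul e e0; exists N => n Nn; rewrite distrC; apply: uN.
Qed.

Lemma scvg_shift u l : scvg u l -> scvg (fun n => u n.+1) l.
Proof. by move=> ul e /ul[N uN]; exists N => n Nn; apply: uN; lia. Qed.

Lemma scvg_unique u l m : scvg u l -> scvg u m -> l = m.
Proof.
move=> ul um; apply/eqP; rewrite -subr_eq0 -normr_eq0; apply/eqP/le_anti.
rewrite normr_ge0 andbT; apply/ler_addgt0Pr => e e0; rewrite add0r.
have e2 : 0 < e / 2%:R by rewrite divr_gt0.
have [N1 h1] := ul _ e2; have [N2 h2] := um _ e2.
have := h1 _ (leq_maxl N1 N2); have := h2 _ (leq_maxr N1 N2).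
set x := u _ => hm hl.
have -> : l - m = (x - m) - (x - l) by ring.
by rewrite (le_trans (ler_normB _ _)) // (splitr e) lerD // ltW.
Qed.

Lemma scvg_le u l c m : scvg u l -> (forall n, `|u n - c| <= m) -> `|l - c| <= m.
Proof.
move=> ul um; apply/ler_addgt0Pr => e e0.
have [N /(_ N (leqnn N)) uN] := ul e e0.
have -> : l - c = (u N - c) - (u N - l) by ring.
by rewrite (le_trans (ler_normB _ _)) // lerD // ltW.
Qed.

Lemma scvgD u v l m : scvg u l -> scvg v m -> scvg (fun n => u n + v n) (l + m).
Proof. by move=> /scvgP ul /scvgP vm; apply/scvgP; apply: cvgD. Qed.

Lemma scvgZ u l c : scvg u l -> scvg (fun n => c * u n) (c * l).
Proof. by move=> /scvgP ul; apply/scvgP; apply: cvgM => //; apply: cvg_cst. Qed.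

End Sequences.

Section ComplexSequences.
Variable R : realType.
Local Notation K := (complexF R).
Import complex.ComplexField.
Local Open Scope complex_scope.

Lemma complexF_archi (x : K) : 0 <= x -> exists n, x < n%:R.
Proof.
case: x => a b; rewrite lecE /= => /andP[/eqP -> a0].
exists (Num.bound a).
have -> : ((Num.bound a)%:R : K) = ((Num.bound a)%:R : R)%:C by rewrite rmorph_nat.
by rewrite ltcR; have := archi_boundP a0.
Qed.

(** Completeness of the reals, applied to real and imaginary parts; the latter is, up to sign, the
    real part after multiplication by i. *)
Lemma complexF_cauchy (u : nat -> K) :
  (forall e, 0 < e -> exists N, forall m n, (N <= m)%N -> (N <= n)%N -> `|u m - u n| < e) ->
  exists l, scvg u l.
Proof.
move=> cu.
have rc (v : nat -> R) : (forall m n, `|v m - v n|%:C <= `|u m - u n| :> K) ->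
    exists l, forall e, 0 < e -> exists N, forall n, (N <= n)%N -> `|v n - l| < e.
  move=> vu.
  have : cvg (v @ \oo).
    apply/cauchy_cvgP/cauchy_ballP => e e0.
    have e0' : 0 < e%:C :> K by rewrite ltcR.
    have [N cN] := cu _ e0'.
    pose B := v @` [set n | (N <= n)%N].
    exists (B, B); first by split; exists N => // n Nn; exists n.
    move=> [_ _] /= [[m Nm <-] [n Nn <-]]; rewrite /ball /= -ltcR.
    exact: le_lt_trans (vu m n) (cN _ _ Nm Nn).
  move=> /cvg_ex[l /cvgrPdist_lt vl]; exists l => e /vl[N _ vN].
  by exists N => n Nn; rewrite distrC; apply: vN.
have [a ua] : exists l, forall e, 0 < e -> exists N, forall n, (N <= n)%N -> `|complex.Re (u n) - l| < e.
  apply: (rc (fun n => complex.Re (u n))) => m n; have := normc_ge_Re (u m - u n).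
  by case: (u m) (u n) => ? ? [? ?].
have [b ub] : exists l, forall e, 0 < e -> exists N, forall n, (N <= n)%N -> `|complex.Im (u n) - l| < e.
  apply: (rc (fun n => complex.Im (u n))) => m n; have := normc_ge_Re ((u m - u n) * 'i).
  rewrite normrM (_ : `|'i| = 1) ?mulr1; last by rewrite normc_def /= expr0n expr1n add0r sqrtr1.
  case: (u m) (u n) => ? ? [? ?]; rewrite ReiNIm /= normrN; exact.
exists (a +i* b) => -[e e'] ee; move: (ee); rewrite ltcE /= => /andP[/eqP e'0 e0].
have e2 : 0 < e / 2%:R by rewrite divr_gt0.
have [N1 h1] := ua _ e2; have [N2 h2] := ub _ e2.
exists (maxn N1 N2) => n; rewrite geq_max => /andP[/h1 n1 /h2 n2].
have -> : u n - (a +i* b) = (complex.Re (u n) - a)%:C + 'i * (complex.Im (u n) - b)%:C.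
  by case: (u n) => x y; rewrite [RHS]/(_ + _) /= ; simpc.
rewrite (le_lt_trans (ler_normD _ _)) // normrM.
rewrite (_ : `|'i| = 1) ?mul1r; last by rewrite normc_def /= expr0n expr1n add0r sqrtr1.
have nC (x : R) : `|x%:C| = `|x|%:C :> K by rewrite normc_def /= expr0n addr0 sqrtr_sqr.
rewrite !nC e'0 -[_ +i* 0]/(e%:C) -rmorphD ltcR (splitr e) ltrD //.
Qed.

End ComplexSequences.

Section PowerRemainder.
Variable K : numFieldType.
Implicit Types z t d : K.

(** The product rule for z * z^j; at j = 0 the truncated exponent is masked by the factor 0. *)
Lemma mulrn_expS z j : j.+1%:R * z ^+ j = z ^+ j + z * (j%:R * z ^+ j.-1).
Proof.
case: j => [|j]; first by rewrite mulr0n mul0r mulr0 addr0 mul1r.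
by rewrite /= [in LHS]mulrS mulrDl mul1r mulrCA -exprS.
Qed.

(* Both sides satisfy the recursion E(j+1) = (z + t) E(j) + j t^2 z^(j-1). *)
Lemma exp_remainder z t d j : 0 <= d -> `|t| <= d ->
  `|(z + t) ^+ j - z ^+ j - t * (j%:R * z ^+ j.-1)| * d ^+ 2 <=
  `|t| ^+ 2 * ((`|z| + d) ^+ j - `|z| ^+ j - d * (j%:R * `|z| ^+ j.-1)).
Proof.
move=> d0 td.
elim: j => [|j IH]; first by rewrite !mul0r !mulr0 !subrr normr0 mul0r mulr0.
rewrite !(exprS _ j) !mulrn_expS.
set a := j%:R * z ^+ j.-1 in IH *; set b := j%:R * `|z| ^+ j.-1 in IH *.
have ab : `|a| = b by rewrite /a normrM normrX normr_nat.
set E := _ - _ - t * a in IH; set F := _ - _ - d * b in IH.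
have -> : (z + t) * (z + t) ^+ j - z * z ^+ j - t * (z ^+ j + z * a) = (z + t) * E + t ^+ 2 * a.
  by rewrite /E; ring.
have -> : (`|z| + d) * (`|z| + d) ^+ j - `|z| * `|z| ^+ j - d * (`|z| ^+ j + `|z| * b) =
  (`|z| + d) * F + d ^+ 2 * b by rewrite /F; ring.
have zt : `|z + t| <= `|z| + d by rewrite (le_trans (ler_normD _ _)) // lerD2l.
have d2 : 0 <= d ^+ 2 by rewrite exprn_ge0.
have b0 : 0 <= b by rewrite -ab.
clearbody E F; clearbody a b.
apply: (@le_trans _ _ ((`|z + t| * `|E| + `|t| ^+ 2 * b) * d ^+ 2)).
  by rewrite ler_wpM2r // (le_trans (ler_normD _ _)) // (normrM _ E) (normrM _ a) normrX ab.
have -> : (`|z + t| * `|E| + `|t| ^+ 2 * b) * d ^+ 2 =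
  `|z + t| * (`|E| * d ^+ 2) + `|t| ^+ 2 * d ^+ 2 * b by ring.
have -> : `|t| ^+ 2 * ((`|z| + d) * F + d ^+ 2 * b) =
  (`|z| + d) * (`|t| ^+ 2 * F) + `|t| ^+ 2 * d ^+ 2 * b by ring.
by rewrite lerD2r ler_pM // mulr_ge0.
Qed.

(** The left side is the linear term in [d] of the binomial expansion of the right side. *)
Lemma exp_derive_le z d j : 0 <= d -> d * (j%:R * `|z| ^+ j.-1) <= (`|z| + d) ^+ j.
Proof.
move=> d0; elim: j => [|j IH]; first by rewrite mul0r mulr0.
rewrite mulrn_expS exprS.
set b := j%:R * _ in IH *.
have -> : d * (`|z| ^+ j + `|z| * b) = d * `|z| ^+ j + `|z| * (d * b) by ring.
rewrite mulrDl addrC; apply: lerD; first by rewrite ler_wpM2l.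
by rewrite ler_wpM2l // lerXn2r ?nnegrE ?addr_ge0 // lerDl.
Qed.

Lemma exp_derive_norm_le z d j : 0 <= d -> d * `|j%:R * z ^+ j.-1| <= (`|z| + d) ^+ j.
Proof. by move=> d0; rewrite normrM normrX normr_nat exp_derive_le. Qed.

Lemma exp_remainder_le z t d j : 0 <= d -> `|t| <= d ->
  `|(z + t) ^+ j - z ^+ j - t * (j%:R * z ^+ j.-1)| * d ^+ 2 <= `|t| ^+ 2 * (`|z| + d) ^+ j.
Proof.
move=> d0 td; apply: le_trans (exp_remainder z j d0 td) _.
rewrite ler_wpM2l ?exprn_ge0 // -addrA gerDl -opprD oppr_le0.
by rewrite addr_ge0 ?mulr_ge0 ?exprn_ge0.
Qed.

End PowerRemainder.

Section PowerSeries.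
Variable R : realType.
Local Notation K := (complexF R).
Implicit Types (x y z t : K).

Lemma scvg_harmonic (v : nat -> K) (C : K) : 0 <= C ->
  (forall n, `|v n| <= C / n.+1%:R) -> scvg v 0.
Proof.
move=> C0 vC e e0; have [N CN] := complexF_archi (divr_ge0 C0 (ltW e0)).
exists N => n Nn; rewrite subr0 (le_lt_trans (vC n)) // ltr_pdivrMr ?ltr0n //.
rewrite mulrC -ltr_pdivrMr // (lt_le_trans CN) // ler_nat.
exact: leq_trans Nn _.
Qed.

(** A quadratic remainder bound uniform in N survives the limit, so differentiability follows
    without Cauchy's integral formula. The coefficients depend on N because square partial sums,
    with the other variable frozen, are truncated in both indices. *)
Lemma poly_limit_derive (b : nat -> nat -> K) (phi : K -> K) z (d M : K) :
  0 < d -> (forall N, \sum_(j < N) `|b N j| * (`|z| + d) ^+ j <= M) ->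
  (forall t, `|t| <= d -> scvg (fun N => \sum_(j < N) b N j * (z + t) ^+ j) (phi t)) ->
  exists l, scvg (fun N => \sum_(j < N) b N j * (j%:R * z ^+ j.-1)) l /\
    forall t, `|t| <= d -> `|phi t - phi 0 - t * l| <= `|t| ^+ 2 * M / d ^+ 2.
Proof.
move=> d0 bM cv.
pose P N t := \sum_(j < N) b N j * (z + t) ^+ j.
pose P' N := \sum_(j < N) b N j * (j%:R * z ^+ j.-1).
have d2 : 0 < d ^+ 2 by rewrite exprn_gt0.
have M0 : 0 <= M by apply: le_trans (bM 0%N); rewrite big_ord0.
(* Uniform in N, hence the derivatives form a Cauchy sequence. *)
have rem N t : `|t| <= d -> `|P N t - P N 0 - t * P' N| <= `|t| ^+ 2 * M / d ^+ 2.
  move=> td; rewrite ler_pdivlMr //.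
  have -> : P N t - P N 0 - t * P' N =
      \sum_(j < N) b N j * ((z + t) ^+ j - z ^+ j - t * (j%:R * z ^+ j.-1)).
    rewrite /P /P' mulr_sumr -!sumrB; apply: eq_bigr => j _; rewrite addr0; ring.
  apply: (@le_trans _ _ (\sum_(j < N) `|t| ^+ 2 * (`|b N j| * (`|z| + d) ^+ j))).
    apply: le_trans (ler_wpM2r (ltW d2) (ler_norm_sum _ _ _)) _.
    rewrite mulr_suml; apply: ler_sum => j _; rewrite normrM -mulrA [leRHS]mulrCA.
    by rewrite ler_wpM2l // exp_remainder_le // ltW.
  by rewrite -mulr_sumr ler_wpM2l ?exprn_ge0.
have [l Pl] : exists l, scvg P' l.
  apply: complexF_cauchy => e e0.
  (* The choice t = e d^2 / q gives both t <= d and t M / d^2 < e / 4, also when M = 0. Four errors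
     below te/8 and two remainders below te/4 then add up to less than te. *)
  pose q := e * d + 4%:R * M.
  have q0 : 0 < q by rewrite ltr_wpDr ?mulr_gt0 ?mulr_ge0.
  pose t : K := e * d ^+ 2 / q.
  have t0 : 0 < t by rewrite divr_gt0 ?mulr_gt0.
  have td : `|t| <= d.
    rewrite gtr0_norm // ler_pdivrMr // /q mulrDr.
    by rewrite (_ : e * d ^+ 2 = d * (e * d)) ?lerDl ?mulr_ge0 ?(ltW d0) //; ring.
  have tM : t * M / d ^+ 2 < e / 4%:R.
    rewrite /t (_ : _ / d ^+ 2 = e * M / q); last first.
      by field; rewrite !gt_eqF.
    rewrite ltr_pdivrMr // -subr_gt0 (_ : _ - _ = e * e * d / 4%:R); last by rewrite /q; field.
    by rewrite divr_gt0 ?mulr_gt0.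
  have te : 0 < t * e / 8%:R by rewrite divr_gt0 ?ltr0n // (mulr_gt0 t0 e0).
  have d00 : `|0 : K| <= d by rewrite normr0 ltW.
  have [N1 h1] := cv t td _ te; have [N2 h2] := cv 0 d00 _ te.
  exists (maxn N1 N2) => m n; rewrite !geq_max => /andP[m1 m2] /andP[n1 n2].
  have := h1 _ m1; have := h1 _ n1; have := h2 _ m2; have := h2 _ n2.
  rewrite -!/(P _ _) => {}h1 {}h2 h3 h4.
  rewrite -(ltr_pM2l t0) -{1}(gtr0_norm t0) -normrM.
  have -> : t * (P' m - P' n) =
    ((P m t - phi t) - (P n t - phi t)) - ((P m 0 - phi 0) - (P n 0 - phi 0))
     - ((P m t - P m 0 - t * P' m) - (P n t - P n 0 - t * P' n)) by ring.
  apply: (le_lt_trans (ler_normB _ _)).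
  apply: (@lt_le_trans _ _ ((t * e / 8%:R + t * e / 8%:R + (t * e / 8%:R + t * e / 8%:R)) +
     (t * (e / 4%:R) + t * (e / 4%:R)))).
    apply: ltrD.
      apply: (le_lt_trans (ler_normB _ _)); apply: ltrD;
      apply: (le_lt_trans (ler_normB _ _)); exact: ltrD.
    have rt N : `|P N t - P N 0 - t * P' N| < t * (e / 4%:R).
      apply: le_lt_trans (rem N _ td) _; rewrite gtr0_norm //.
      by rewrite (_ : t ^+ 2 * M / d ^+ 2 = t * (t * M / d ^+ 2)) ?ltr_pM2l //; ring.
    by apply: (le_lt_trans (ler_normB _ _)); apply: ltrD.
  by rewrite le_eqVlt (_ : _ + _ = t * e) ?eqxx //; field.
exists l; split=> // t td.
rewrite -[X in `|X|]subr0; apply: (@scvg_le _ (fun N => P N t - P N 0 - t * P' N)); last first.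
  by move=> N; rewrite subr0 rem.
have c0 : scvg (P ^~ 0) (phi 0) by apply: cv; rewrite normr0 ltW.
have := scvgD (scvgD (cv t td) (scvgZ (-1) c0)) (scvgZ (- t) Pl).
have -> : phi t + -1 * phi 0 + - t * l = phi t - phi 0 - t * l by ring.
by congr scvg; apply/funext => N; rewrite mulN1r mulNr.
Qed.

Lemma quotient_cvg (phi : K -> K) (d M l : K) : 0 < d -> 0 <= M ->
  (forall t, `|t| <= d -> `|phi t - phi 0 - t * l| <= `|t| ^+ 2 * M / d ^+ 2) ->
  (fun h => h^-1 *: (phi h - phi 0)) @ 0^' --> l.
Proof.
move=> d0 M0 H; apply/cvgrPdist_lt => e e0.
have d2 : 0 < d ^+ 2 by rewrite exprn_gt0.
have q0 : 0 < e * d + M by rewrite ltr_wpDr ?mulr_gt0.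
pose c := e * d ^+ 2 / (e * d + M).
have c0 : 0 < c by rewrite divr_gt0 ?mulr_gt0.
near=> h.
have h0 : h != 0 by near: h; exact: nbhs_dnbhs_neq.
have hc : `|h| < c.
  near: h; apply: nbhs_dnbhs; exact: (@nbhs0_lt _ K).
have hd : `|h| <= d.
  apply: le_trans (ltW hc) _; rewrite ler_pdivrMr // mulrDr.
  by rewrite (_ : e * d ^+ 2 = d * (e * d)) ?lerDl ?mulr_ge0 ?(ltW d0) //; ring.
have -> : l - h^-1 *: (phi h - phi 0) = - h^-1 * (phi h - phi 0 - h * l).
  by rewrite /GRing.scale /=; field.
rewrite normrM normrN normfV -ltr_pdivlMl ?invr_gt0 ?normr_gt0 // invrK.
apply: le_lt_trans (H _ hd) _.
rewrite -mulrA expr2 -mulrA ltr_pM2l ?normr_gt0 //.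
have [->|M1] := eqVneq M 0; first by rewrite mul0r mulr0.
have Mp : 0 < M by rewrite lt_neqAle eq_sym M1.
apply: (@lt_le_trans _ _ (c * (M / d ^+ 2))); first by rewrite ltr_pM2r ?divr_gt0.
rewrite /c (_ : _ * (M / _) = e * (M / (e * d + M))); last by field; rewrite !gt_eqF.
by rewrite ler_piMr ?(ltW e0) // ler_pdivrMr // mul1r lerDr mulr_ge0 // ltW.
Unshelve. all: by end_near. Qed.

Definition sqsum (c : nat -> nat -> K) N x y :=
  \sum_(j < N) \sum_(k < N) c j k * x ^+ j * y ^+ k.
Definition sqabs (c : nat -> nat -> K) N x y :=
  \sum_(j < N) \sum_(k < N) `|c j k * x ^+ j * y ^+ k|.

Definition dbl_series (c : nat -> nat -> K) (r : K) (phi : K -> K -> K) :=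
  forall x y, `|x| < r -> `|y| < r ->
    (exists M, forall N, sqabs c N x y <= M) /\
    scvg (fun N => sqsum c N x y) (phi x y).

Definition d1coef (c : nat -> nat -> K) j k := j.+1%:R * c j.+1 k.
Definition d2coef (c : nat -> nat -> K) j k := k.+1%:R * c j k.+1.

(** With y frozen, a square partial sum is a polynomial in x to which [poly_limit_derive] applies;
    its derivative and the square partial sum of the derived series differ by one row. *)
Lemma dbl_series_derive1 c r phi : dbl_series c r phi -> exists psi,
  dbl_series (d1coef c) r psi /\ forall x y, `|x| < r -> `|y| < r ->
    (fun h => h^-1 *: (phi (x + h) y - phi x y)) @ 0^' --> psi x y.
Proof.
move=> H.
suff D x y : `|x| < r -> `|y| < r -> (exists M, forall N, sqabs (d1coef c) N x y <= M) /\
    exists l, scvg (fun N => sqsum (d1coef c) N x y) l /\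
     (fun h => h^-1 *: (phi (x + h) y - phi x y)) @ 0^' --> l.
  have /choice[psi hpsi] : forall p : K * K, exists l, `|p.1| < r -> `|p.2| < r ->
      scvg (fun N => sqsum (d1coef c) N p.1 p.2) l /\
      (fun h => h^-1 *: (phi (p.1 + h) p.2 - phi p.1 p.2)) @ 0^' --> l.
    move=> [x y] /=; have [xr|?] := pselect (`|x| < r); last by exists 0.
    have [yr|?] := pselect (`|y| < r); last by exists 0.
    by have [_ [l hl]] := D x y xr yr; exists l.
  exists (fun x y => psi (x, y)); split=> x y xr yr; last by have [] := hpsi (x, y) xr yr.
  by have [? _] := D x y xr yr; split=> //; have [] := hpsi (x, y) xr yr.
move=> xr yr.
(* One third of the gap absorbs a derivative, a second one supplies the factor 1/N for the boundary
   row, and the last keeps X below r. *)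
pose d := (r - `|x|) / 3%:R.
have d0 : 0 < d by rewrite divr_gt0 ?subr_gt0.
pose X := `|x| + d + d.
have X0 : 0 <= X by rewrite !addr_ge0 ?(ltW d0).
have Xr : `|X| < r.
  rewrite ger0_norm // /X -subr_gt0.
  by rewrite (_ : r - _ = d) //; rewrite /d; field.
have xd0 : 0 <= `|x| + d by rewrite addr_ge0 ?(ltW d0).
have [[M HM] _] := H X y Xr yr.
have M0 : 0 <= M by apply: le_trans (HM 0%N); rewrite /sqabs big_ord0.
have XX j : X ^+ j = `|X ^+ j| by rewrite ger0_norm ?exprn_ge0.
pose b N j := \sum_(k < N) c j k * y ^+ k.
have bX N : \sum_(j < N) `|b N j| * X ^+ j <= M.
  apply: le_trans (HM N); apply: ler_sum => j _.
  rewrite {1}XX -normrM mulr_suml.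
  apply: le_trans (ler_norm_sum _ _ _) _.
  by apply: ler_sum => k _; rewrite mulrAC.
have bd N : \sum_(j < N) `|b N j| * (`|x| + d) ^+ j <= M.
  apply: le_trans (bX N); apply: ler_sum => j _.
  by rewrite ler_wpM2l // lerXn2r ?nnegrE // lerDl ltW.
have cvb t : `|t| <= d -> scvg (fun N => \sum_(j < N) b N j * (x + t) ^+ j) (phi (x + t) y).
  move=> td.
  have xt : `|x + t| < r.
    apply: le_lt_trans Xr; rewrite (ger0_norm X0) /X -addrA.
    by rewrite (le_trans (ler_normD _ _)) // lerD2l (le_trans td) // lerDl ltW.
  have [_] := H _ _ xt yr; congr scvg; apply/funext => N; apply: eq_bigr => j _.
  by rewrite mulr_suml; apply: eq_bigr => k _; rewrite mulrAC.
have [l [Pl lE]] := @poly_limit_derive b (fun t => phi (x + t) y) x d M d0 bd cvb.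
split.
  exists (M / d) => N; rewrite ler_pdivlMr // mulr_suml.
  apply: le_trans (HM N.+1); rewrite /sqabs big_ord_recl ler_wpDl ?sumr_ge0 //.
  apply: ler_sum => j _; rewrite big_ord_recr ler_wpDr // mulr_suml.
  apply: ler_sum => k _ /=; rewrite /bump /= add1n.
  have -> : d1coef c j k * x ^+ j * y ^+ k = c j.+1 k * y ^+ k * (j.+1%:R * x ^+ j).
    by rewrite /d1coef; ring.
  rewrite [c j.+1 k * X ^+ _ * _]mulrAC (normrM _ (X ^+ _)) (normrM _ (_ * _ ^+ j)) -mulrA.
  rewrite ler_wpM2l // mulrC (le_trans (exp_derive_norm_le x j.+1 (ltW d0))) // -XX.
  by rewrite lerXn2r ?nnegrE // lerDl ltW.
exists l; split; last first.
  have := @quotient_cvg (fun t => phi (x + t) y) d M l d0 M0 lE.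
  by rewrite addr0.
(* The row j = N, present in the derived square sum but not in the derivative of the square sum of
   size N; it is O(1/N). *)
pose err N := b N N * (N%:R * x ^+ N.-1).
have err0 : scvg err 0.
  have C0 : 0 <= M * X / d ^+ 2 by rewrite divr_ge0 ?(mulr_ge0 M0 X0) // exprn_ge0 // ltW.
  apply: (scvg_harmonic C0) => N.
  have bN : `|b N N| * X ^+ N <= M.
    apply: le_trans (HM N.+1); rewrite /sqabs big_ord_recr ler_wpDl ?sumr_ge0 //=.
      by move=> i _; rewrite sumr_ge0.
    rewrite big_ord_recr ler_wpDr //= {1}XX -normrM mulr_suml.
    apply: le_trans (ler_norm_sum _ _ _) _.
    by apply: ler_sum => k _; rewrite mulrAC.
  rewrite ler_pdivlMr ?ltr0n // ler_pdivlMr ?exprn_gt0 // /err normrM.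
  apply: (@le_trans _ _ (`|b N N| * (X * X ^+ N))); last by rewrite mulrCA mulrC ler_wpM2r.
  rewrite -!mulrA ler_wpM2l //.
  apply: (@le_trans _ _ ((`|x| + d) ^+ N * (N.+1%:R * d))).
    rewrite (_ : _ * (N.+1%:R * d ^+ 2) = d * `|N%:R * x ^+ N.-1| * (N.+1%:R * d)); last by ring.
    apply: ler_wpM2r; last exact: (exp_derive_norm_le x N (ltW d0)).
    by apply: mulr_ge0 => //; apply: ltW.
  have := exp_derive_le (`|x| + d) N.+1 (ltW d0).
  rewrite (ger0_norm xd0) -/X -exprS /=; apply: le_trans.
  suff -> : (`|x| + d) ^+ N * (N.+1%:R * d) = d * (N.+1%:R * (`|x| + d) ^+ N) by [].
  by ring.
have := scvgD Pl err0; rewrite addr0; congr scvg; apply/funext => N.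
rewrite /sqsum /err.
transitivity (\sum_(j < N.+1) b N j * (j%:R * x ^+ j.-1)); first by rewrite big_ord_recr.
rewrite big_ord_recl mul0r mulr0 add0r; apply: eq_bigr => j _.
rewrite mulr_suml; apply: eq_bigr => k _ /=.
by rewrite /bump /= add1n /d1coef; ring.
Qed.

Lemma dbl_series_tr c r phi : dbl_series c r phi ->
  dbl_series (fun j k => c k j) r (fun x y => phi y x).
Proof.
move=> H x y xr yr; have [[M HM] cv] := H y x yr xr; split.
  exists M => N; apply: le_trans (HM N); rewrite /sqabs exchange_big /=.
  by apply: ler_sum => j _; apply: ler_sum => k _; rewrite mulrAC.
move: cv; congr scvg; apply/funext => N; rewrite /sqsum exchange_big /=.
by apply: eq_bigr => j _; apply: eq_bigr => k _; rewrite mulrAC.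
Qed.

Lemma dbl_series_derive2 c r phi : dbl_series c r phi -> exists psi,
  dbl_series (d2coef c) r psi /\ forall x y, `|x| < r -> `|y| < r ->
    (fun h => h^-1 *: (phi x (y + h) - phi x y)) @ 0^' --> psi x y.
Proof.
move=> /dbl_series_tr/dbl_series_derive1[psi [/dbl_series_tr Hpsi dpsi]].
exists (fun x y => psi y x); split; first exact: Hpsi.
by move=> x y xr yr; exact: (dpsi y x yr xr).
Qed.

Lemma dbl_series_at0 c r phi : 0 < r -> dbl_series c r phi -> phi 0 0 = c 0%N 0%N.
Proof.
move=> r0 /(_ 0 0); rewrite normr0 => /(_ r0 r0) [_ cv].
apply: (scvg_unique cv); move=> e e0; exists 1%N => -[//|n] _.
rewrite /sqsum big_ord_recl [X in _ + X - _]big1 => [|j _]; last first.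
  by rewrite big1 // => k _; rewrite expr0n /= mulr0 mul0r.
rewrite addr0 big_ord_recl [X in _ + X - _]big1 => [|k _]; last by rewrite !expr0n /= mulr0.
by rewrite !expr0 !mulr1 addr0 subrr normr0.
Qed.

(* Continuity at the centre only, which suffices for functions analytic at
   every point. *)
Lemma dbl_series_cont c r phi : 0 < r -> dbl_series c r phi ->
  exists C, 0 <= C /\ forall x y s, `|x| <= s -> `|y| <= s -> s <= r / 2%:R ->
    `|phi x y - c 0%N 0%N| <= C * s.
Proof.
move=> r0 H.
have r2 : 0 < r / 2%:R by rewrite divr_gt0.
have r2r : `|r / 2%:R| < r by rewrite gtr0_norm // ltr_pdivrMr // ltr_pMr // ltr1n.
have [[M HM] _] := H _ _ r2r r2r.
have M0 : 0 <= M by apply: le_trans (HM 0%N); rewrite /sqabs big_ord0.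
exists (M / (r / 2%:R)); split; first by rewrite divr_ge0 // ltW.
move=> x y s xs ys sr.
have s0 : 0 <= s by apply: le_trans xs.
have lts (u : K) : `|u| <= s -> `|u| < r.
  by move=> us; apply: le_lt_trans (le_trans us sr) _; rewrite -(gtr0_norm r2).
have [_ cv] := H x y (lts _ xs) (lts _ ys).
apply: (scvg_le (scvg_shift cv)) => N.
(* Every term other than the constant one shrinks at least by the factor q <= 1 when the radius
   drops from r/2 to s. *)
set q := s / (r / 2%:R).
have q0 : 0 <= q by rewrite divr_ge0 // ltW.
have q1 : q <= 1 by rewrite ler_pdivrMr // mul1r.
have sq : s = q * (r / 2%:R) by rewrite /q divfK ?gt_eqF.
have -> : M / (r / 2%:R) * s = M * q by rewrite /q; ring.
clearbody q.
have term j k : (0 < j + k)%N -> `|c j k * x ^+ j * y ^+ k| <=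
     q * `|c j k * (r / 2%:R) ^+ j * (r / 2%:R) ^+ k|.
  move=> jk; rewrite -!mulrA !(normrM (c j k)) [leRHS]mulrCA ler_wpM2l //.
  rewrite [`|(r / _) ^+ j * _|]ger0_norm ?(mulr_ge0 (exprn_ge0 _ (ltW r2)) (exprn_ge0 _ (ltW r2))) //.
  apply: (@le_trans _ _ (s ^+ j * s ^+ k)).
    by rewrite normrM !normrX ler_pM ?exprn_ge0 // lerXn2r ?nnegrE.
  rewrite sq ![(q * _) ^+ _]exprMn mulrACA -exprD ler_wpM2r ?(mulr_ge0 (exprn_ge0 _ (ltW r2)) (exprn_ge0 _ (ltW r2))) //.
  by rewrite ler_iXnr.
have -> : sqsum c N.+1 x y - c 0%N 0%N = \sum_(j < N.+1) \sum_(k < N.+1)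
    (if (0 < j + k)%N then c j k * x ^+ j * y ^+ k else 0).
  rewrite /sqsum big_ord_recl [in RHS]big_ord_recl addrAC; congr (_ + _).
  rewrite big_ord_recl [in RHS]big_ord_recl /= !expr0 !mulr1 addrAC subrr.
  by congr (_ + _); apply: eq_bigr => k _; rewrite lift0.
apply: (@le_trans _ _ (q * sqabs c N.+1 (r / 2%:R) (r / 2%:R))); last first.
  by rewrite mulrC ler_wpM2r.
rewrite /sqabs mulr_sumr; apply: le_trans (ler_norm_sum _ _ _) _.
apply: ler_sum => j _; rewrite mulr_sumr; apply: le_trans (ler_norm_sum _ _ _) _.
apply: ler_sum => k _; case: ifP => jk; first exact: term.
by rewrite normr0 mulr_ge0.
Qed.

End PowerSeries.

(** * Taylor jets of analytic functions *)

Section Analytic.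
Variable R : realType.
Local Notation K := (complexF R).
Local Notation "''V'" := 'rV[K]_2.
Implicit Types (f g : 'V -> K) (p q : 'V) (x y : K) (U W : set 'V).

Definition vec x y : 'V := \row_i (if i == 0 then x else y).

Lemma ord2E (i : 'I_2) : i = 0 \/ i = 1.
Proof. by case: i => [[|[|//]] ?]; [left|right]; apply: val_inj. Qed.

Lemma vecE (h : 'V) : h = vec (h 0 0) (h 0 1).
Proof. by apply/rowP => i; rewrite mxE; case: (ord2E i) => ->. Qed.

Lemma vec0 : vec 0 0 = 0.
Proof. by apply/rowP => i; rewrite !mxE if_same. Qed.

Lemma norm_vec_lt r x y : 0 < r -> (`|vec x y| < r) <-> (`|x| < r /\ `|y| < r).
Proof.
move=> r0.
have -> : (`|vec x y| < r) <-> ball (0 : 'V) r (vec x y).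
  by rewrite mx_norm_ball /ball_ /= sub0r normrN.
split=> [[_ h]|[xr yr]].
  have := h 0 0; have := h 0 1; rewrite /ball /= !mxE /= !sub0r !normrN.
  by split.
split=> // i j; rewrite /ball /= !mxE sub0r normrN.
by case: ifP.
Qed.

Definition loc f p x y := f (p + vec x y).

Lemma analytic_atP f p : analytic_at f p <->
  exists c r, 0 < r /\ dbl_series c r (loc f p).
Proof.
split=> -[c [r [r0 H]]]; exists c, r; split=> //.
  move=> x y xr yr; have hr : `|vec x y| < r by apply/norm_vec_lt.
  have [B C] := H _ hr; rewrite !mxE /= in B C.
  by split=> //; apply/scvgP.
move=> h hr; rewrite (vecE h) in hr *.
have [xr yr] := (norm_vec_lt _ _ r0).1 hr.
have [B /scvgP C] := H _ _ xr yr; rewrite !mxE /=.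
by split.
Qed.

Lemma dbl_series_eq c r (phi psi : K -> K -> K) :
  (forall x y, `|x| < r -> `|y| < r -> phi x y = psi x y) ->
  dbl_series c r phi -> dbl_series c r psi.
Proof. by move=> E H x y xr yr; rewrite -E //; apply: H. Qed.

(** The derived series represents the partial derivative on the whole polydisc, so iteration costs
    no radius. *)
Lemma dbl_pderiv0 f p c r : dbl_series c r (loc f p) ->
  dbl_series (d1coef c) r (loc (pderiv 0 f) p) /\
  forall x y, `|x| < r -> `|y| < r -> derivable f (p + vec x y) (delta_mx 0 0).
Proof.
move=> /dbl_series_derive1[psi [Hpsi dpsi]].
have D x y : `|x| < r -> `|y| < r ->
    (fun h => h^-1 *: ((f \o shift (p + vec x y)) (h *: delta_mx 0 0) - f (p + vec x y)))
      @ 0^' --> psi x y.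
  move=> xr yr; have := dpsi x y xr yr; set u := (X in X @ _ --> _) => uE.
  have -> // : (fun h => h^-1 *: ((f \o shift (p + vec x y)) (h *: delta_mx 0 0) -
      f (p + vec x y))) = u.
  apply/funext => h; rewrite /u /loc /shift /=; congr (_ *: (f _ - _)).
  by apply/rowP => i; rewrite !mxE; case: (ord2E i) => -> /=; ring.
split=> [|x y xr yr]; last by apply/cvg_ex; exists (psi x y); apply: D.
apply: dbl_series_eq Hpsi => x y xr yr; apply/esym.
exact: (cvg_lim _ (D x y xr yr)).
Qed.

Lemma dbl_pderiv1 f p c r : dbl_series c r (loc f p) ->
  dbl_series (d2coef c) r (loc (pderiv 1 f) p) /\
  forall x y, `|x| < r -> `|y| < r -> derivable f (p + vec x y) (delta_mx 0 1).
Proof.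
move=> /dbl_series_derive2[psi [Hpsi dpsi]].
have D x y : `|x| < r -> `|y| < r ->
    (fun h => h^-1 *: ((f \o shift (p + vec x y)) (h *: delta_mx 0 1) - f (p + vec x y)))
      @ 0^' --> psi x y.
  move=> xr yr; have := dpsi x y xr yr; set u := (X in X @ _ --> _) => uE.
  have -> // : (fun h => h^-1 *: ((f \o shift (p + vec x y)) (h *: delta_mx 0 1) -
      f (p + vec x y))) = u.
  apply/funext => h; rewrite /u /loc /shift /=; congr (_ *: (f _ - _)).
  by apply/rowP => i; rewrite !mxE; case: (ord2E i) => -> /=; ring.
split=> [|x y xr yr]; last by apply/cvg_ex; exists (psi x y); apply: D.
apply: dbl_series_eq Hpsi => x y xr yr; apply/esym.
exact: (cvg_lim _ (D x y xr yr)).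
Qed.

Lemma analytic_at_pderiv f p i : analytic_at f p ->
  analytic_at (pderiv i f) p /\ derivable f p (delta_mx 0 i).
Proof.
move=> /analytic_atP[c [r [r0 H]]].
have [H0 D0] := dbl_pderiv0 H; have [H1 D1] := dbl_pderiv1 H.
have z : `|0 : K| < r by rewrite normr0.
case: (ord2E i) => ->.
  split; first by apply/analytic_atP; exists (d1coef c), r.
  by have := D0 0 0 z z; rewrite vec0 addr0.
split; first by apply/analytic_atP; exists (d2coef c), r.
by have := D1 0 0 z z; rewrite vec0 addr0.
Qed.

Lemma loc0 f p : loc f p 0 0 = f p.
Proof. by rewrite /loc vec0 addr0. Qed.

Lemma analytic_at_pderivC f p : analytic_at f p ->
  pderiv 0 (pderiv 1 f) p = pderiv 1 (pderiv 0 f) p.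
Proof.
move=> /analytic_atP[c [r [r0 H]]].
have [H01 _] := dbl_pderiv0 (dbl_pderiv1 H).1.
have [H10 _] := dbl_pderiv1 (dbl_pderiv0 H).1.
have e01 := dbl_series_at0 r0 H01; have e10 := dbl_series_at0 r0 H10.
rewrite loc0 in e01; rewrite loc0 in e10; apply: (etrans e01); apply/esym.
by apply: (etrans e10); rewrite /d1coef /d2coef mulrCA.
Qed.

Definition taylor p f : jet K := fun i j => iter j (pderiv 1) (iter i (pderiv 0) f) p.

(** The factor is i! j!, but only its positivity is recorded: it is enough to pass from a vanishing
    jet to vanishing coefficients. *)
Lemma taylor_coef f p c r i j : 0 < r -> dbl_series c r (loc f p) ->
  exists2 m, (0 < m)%N & taylor p f i j = m%:R * c i j.
Proof.
move=> r0 H.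
have [c1 H1 c1E] : exists2 c1, dbl_series c1 r (loc (iter i (pderiv 0) f) p) &
    forall a b, exists2 m, (0 < m)%N & c1 a b = m%:R * c (i + a)%N b.
  elim: i => [|i [c1 H1 c1E]]; first by exists c => // a b; exists 1%N; rewrite ?mul1r.
  exists (d1coef c1); first exact: (dbl_pderiv0 H1).1.
  move=> a b; have [m m0 E] := c1E a.+1 b; exists (a.+1 * m)%N; first by rewrite muln_gt0.
  by rewrite /d1coef E natrM mulrA addnS.
have [c2 H2 c2E] : exists2 c2, dbl_series c2 r (loc (iter j (pderiv 1) (iter i (pderiv 0) f)) p) &
    forall a b, exists2 m, (0 < m)%N & c2 a b = m%:R * c (i + a)%N (j + b)%N.
  elim: j => [|j [c2 H2 c2E]]; first by exists c1.
  exists (d2coef c2); first exact: (dbl_pderiv1 H2).1.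
  move=> a b; have [m m0 E] := c2E a b.+1; exists (b.+1 * m)%N; first by rewrite muln_gt0.
  by rewrite /d2coef E natrM mulrA addnS.
have [m m0 E] := c2E 0%N 0%N; exists m => //.
by have := dbl_series_at0 r0 H2; rewrite loc0 E !addn0.
Qed.

Lemma pderiv_local W f g i : open W -> (forall z : 'V, W z -> f z = g z) ->
  forall z : 'V, W z -> pderiv i f z = pderiv i g z.
Proof.
move=> oW fg x Wx; apply: near_eq_derive.
by near=> z; apply: fg; near: z; exact: open_nbhs_nbhs.
Unshelve. all: by end_near. Qed.

Lemma pderiv_cst i (c : K) : pderiv i (cst c) = cst 0.
Proof. by apply/funext => x; exact: derive_cst. Qed.

Lemma taylor_cst p (c : K) : taylor p (cst c) = jcst c.
Proof.
have E0 n k : iter n (pderiv k) (cst (0 : K)) = cst 0.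
  by elim: n => [//|n IH]; rewrite iterS IH pderiv_cst.
apply: jetP => -[|i] j; rewrite /taylor; last by rewrite iterSr pderiv_cst !E0.
by case: j => [|j] //; rewrite iterSr pderiv_cst E0.
Qed.

Lemma taylor_local W f g p : open W -> (forall z : 'V, W z -> f z = g z) -> W p ->
  taylor p f = taylor p g.
Proof.
move=> oW fg Wp; apply: jetP => i j; rewrite /taylor.
have E (n : nat) k (u v : 'V -> K) : (forall z : 'V, W z -> u z = v z) ->
    forall z : 'V, W z -> iter n (pderiv k) u z = iter n (pderiv k) v z.
  by move=> uv; elim: n => [|n IH]; [exact: uv|exact: (pderiv_local k oW IH)].
exact: (E j 1 _ _ (E i 0 _ _ fg) p Wp).
Qed.

Lemma analytic_on_iter U f i j : analytic_on U f ->
  analytic_on U (iter j (pderiv 1) (iter i (pderiv 0) f)).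
Proof.
have E (n : nat) k (u : 'V -> K) : analytic_on U u -> analytic_on U (iter n (pderiv k) u).
  move=> Hu; elim: n => [//|n IH p Up].
  exact: (analytic_at_pderiv k (IH p Up)).1.
by move=> Hf; exact: (E j 1 _ (E i 0 _ Hf)).
Qed.

Lemma analytic_at_cont f p e : analytic_at f p -> 0 < e ->
  \forall q \near p, `|f q - f p| < e.
Proof.
move=> /analytic_atP[c [r [r0 H]]] e0.
have [C [C0 HC]] := dbl_series_cont r0 H.
have q0 : 0 < e + C * r by rewrite ltr_wpDr ?mulr_ge0 // ltW.
pose s := (r / 2%:R) * (e / (e + C * r)).
have s0 : 0 < s by rewrite !mulr_gt0 ?invr_gt0 ?ltr0n.
have sr : s <= r / 2%:R.
  rewrite ler_piMr //; first by rewrite divr_ge0 ?ltW.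
  by rewrite ler_pdivrMr // mul1r lerDl mulr_ge0 // ltW.
have Cs : C * s < e.
  rewrite /s (_ : C * _ = e * ((C * r / 2%:R) / (e + C * r))); last by field; rewrite gt_eqF.
  rewrite -[ltRHS]mulr1 ltr_pM2l // ltr_pdivrMr // mul1r.
  apply: ltr_pwDl => //; rewrite ler_pdivrMr ?ltr0n //.
  by rewrite ler_peMr ?mulr_ge0 ?ler1n // ltW.
apply/nbhs_ballP; exists s => //= q; rewrite mx_norm_ball /ball_ /= distrC => qs.
have [h qE] : exists h, q = p + h by exists (q - p); rewrite addrC subrK.
rewrite qE addrC addKr (vecE h) in qs *.
have [xs ys] := (norm_vec_lt _ _ s0).1 qs.
rewrite -/(loc f p _ _) -[f p](loc0 f) (dbl_series_at0 r0 H).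
by apply: le_lt_trans Cs; apply: HC => //; apply: ltW.
Qed.

(** The points of U with zero jet form a clopen subset: open since a zero jet means a zero series on
    a ball, closed since all iterated derivatives are analytic and hence continuous. *)
Lemma analytic_identity U f p : open U -> connected U -> analytic_on U f -> U p ->
  taylor p f = 0 -> forall q, U q -> f q = 0.
Proof.
move=> oU cU Hf Up fp.
pose Z := [set q | U q /\ taylor q f = 0].
have Z0 q : Z q -> exists2 W, open W & W q /\ forall z : 'V, W z -> U z /\ f z = 0.
  move=> [Uq fq]; have /analytic_atP[c [r [r0 H]]] := Hf q Uq.
  have c0 i j : c i j = 0.
    have [m m0] := taylor_coef i j r0 H; rewrite fq => /esym/eqP.
    by rewrite mulf_eq0 pnatr_eq0 -[(m == 0)%N]negbK -lt0n m0 => /eqP.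
  exists ((ball q r)^° `&` U); first by apply: openI => //; exact: open_interior.
  split; first by split=> //; exact: nbhsx_ballx.
  move=> x [/interior_subset bx Ux]; split=> //.
  have [h xE] : exists h, x = q + h by exists (x - q); rewrite addrC subrK.
  move: bx; rewrite mx_norm_ball /ball_ /= xE distrC addrC addKr (vecE h).
  move=> /(norm_vec_lt _ _ r0)[xr yr]; have [_ cv] := H _ _ xr yr.
  apply: (scvg_unique cv) => e e0; exists 0%N => n _.
  rewrite /sqsum big1 ?subrr ?normr0 // => j _; rewrite big1 // => k _.
  by rewrite c0 !mul0r.
have ZU : Z = U.
  apply: cU; first by exists p.
    exists Z; last by apply/seteqP; split=> [q [Uq fq]|q [_ Zq]].
    rewrite openE => q Zq; have [W oW [Wq WU]] := Z0 q Zq.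
    rewrite /interior nbhsE; exists W => // x Wx; split; first by have [] := WU x Wx.
    rewrite (@taylor_local W f (cst 0) x) //; last by move=> z /WU[].
    by rewrite taylor_cst; apply: jetP => -[|?] [|?].
  exists (closure Z); first exact: closed_closure.
  apply/seteqP; split=> [q Zq|q [Uq cq]]; first by split; [case: Zq|exact: subset_closure].
  split=> //; apply: jetP => i j; rewrite jzeroE.
  apply/eqP/negPn/negP => n0.
  pose g := iter j (pderiv 1) (iter i (pderiv 0) f).
  have gq : 0 < `|g q| by rewrite normr_gt0.
  have Hg : analytic_at g q := analytic_on_iter i j Hf Uq.
  have [z [[Uz fz] gz]] := cq _ (analytic_at_cont Hg gq).
  move: gz; have -> : g z = 0 by rewrite -[g z]/(taylor z f i j) fz.
  by rewrite sub0r normrN ltxx.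
by move=> q; rewrite -ZU => /Z0[W _ [Wq WU]]; have [] := WU q Wq.
Qed.

End Analytic.

(** * The Taylor map as a homomorphism of differential rings *)

Section Smooth.
Variables (R : realType) (U : set 'rV[complexF R]_2).
Local Notation K := (complexF R).
Local Notation "''V'" := 'rV[K]_2.
Hypothesis oU : open U.
Implicit Types (f g : 'V -> K) (q : 'V).

(* The differential algebra generated by the analytic functions; it spares the
   Cauchy product of double series. *)
Inductive smooth : ('V -> K) -> Prop :=
| smooth_analytic f : analytic_on U f -> smooth f
| smooth_cst c : smooth (cst c)
| smooth_add f g : smooth f -> smooth g -> smooth (f + g)
| smooth_mul f g : smooth f -> smooth g -> smooth (f * g)
| smooth_eq f g : (forall z, U z -> f z = g z) -> smooth f -> smooth g.

Lemma near_on f g q : (forall z, U z -> f z = g z) -> U q -> \near q, f q = g q.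
Proof.
by move=> fg Uq; near=> z; apply: fg; near: z; exact: open_nbhs_nbhs.
Unshelve. all: by end_near. Qed.

Lemma smooth_derivable f i : smooth f -> forall q, U q -> derivable f q (delta_mx 0 i).
Proof.
elim=> {f} [f Hf|c|f g _ IHf _ IHg|f g _ IHf _ IHg|f g fg _ IHf] q Uq.
- exact: (analytic_at_pderiv i (Hf q Uq)).2.
- exact: derivable_cst.
- by apply: derivableD; [exact: IHf|exact: IHg].
- by apply: derivableM; [exact: IHf|exact: IHg].
- exact: near_eq_derivable (near_on fg Uq) (IHf q Uq).
Qed.

Lemma pderiv_add f g i q : smooth f -> smooth g -> U q ->
  pderiv i (f + g) q = pderiv i f q + pderiv i g q.
Proof.
move=> sf sg Uq.
exact: (deriveD (@smooth_derivable f i sf q Uq) (@smooth_derivable g i sg q Uq)).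
Qed.

Lemma pderiv_mul f g i q : smooth f -> smooth g -> U q ->
  pderiv i (f * g) q = pderiv i f q * g q + f q * pderiv i g q.
Proof.
move=> sf sg Uq.
have E := deriveM (@smooth_derivable f i sf q Uq) (@smooth_derivable g i sg q Uq).
have swap (a b c d : K) : a * b + c * d = d * c + a * b by ring.
exact: (etrans E (swap _ _ _ _)).
Qed.

(* Unification must not look inside the limit defining [pderiv]. *)
Opaque pderiv.

Lemma smooth_pderiv f i : smooth f -> smooth (pderiv i f).
Proof.
elim=> {f} [f Hf|c|f g sf IHf sg IHg|f g sf IHf sg IHg|f g fg _ IHf].
- by apply: smooth_analytic => q Uq; exact: (analytic_at_pderiv i (Hf q Uq)).1.
- by rewrite pderiv_cst; exact: smooth_cst.
- apply: (@smooth_eq (pderiv i f + pderiv i g)); last exact: smooth_add.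
  by move=> q Uq; apply: esym; exact: pderiv_add.
- apply: (@smooth_eq (pderiv i f * g + f * pderiv i g)).
    by move=> q Uq; apply: esym; exact: pderiv_mul.
  by apply: smooth_add; apply: smooth_mul.
- by apply: smooth_eq IHf => q Uq; exact: (pderiv_local i oU fg).
Qed.

Lemma smooth_pderivC f : smooth f -> forall q, U q ->
  pderiv 0 (pderiv 1 f) q = pderiv 1 (pderiv 0 f) q.
Proof.
have loc i (u v : 'V -> K) := @pderiv_local R U u v i oU.
elim=> {f} [f Hf|c|f g sf IHf sg IHg|f g sf IHf sg IHg|f g fg sf IHf] q Uq.
- exact: analytic_at_pderivC (Hf q Uq).
- by rewrite !pderiv_cst.
- have E k l : pderiv k (pderiv l (f + g)) q =
      pderiv k (pderiv l f) q + pderiv k (pderiv l g) q.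
    apply: (etrans (loc k _ _ (fun z Uz => pderiv_add l sf sg Uz) q Uq)).
    exact: (pderiv_add k (smooth_pderiv l sf) (smooth_pderiv l sg) Uq).
  apply: (etrans (E 0 1)); apply: (etrans _ (esym (E 1 0))).
  exact: (congr2 +%R (IHf q Uq) (IHg q Uq)).
- have E k l : pderiv k (pderiv l (f * g)) q =
      pderiv k (pderiv l f) q * g q + pderiv l f q * pderiv k g q +
      (pderiv k f q * pderiv l g q + f q * pderiv k (pderiv l g) q).
    have sf' := smooth_pderiv l sf; have sg' := smooth_pderiv l sg.
    apply: (etrans (loc k _ _ (fun z Uz => pderiv_mul l sf sg Uz) q Uq)).
    apply: (etrans (pderiv_add k (smooth_mul sf' sg) (smooth_mul sf sg') Uq)).
    exact: (congr2 +%R (pderiv_mul k sf' sg Uq) (pderiv_mul k sf sg' Uq)).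
  apply: (etrans (E 0 1)); apply: (etrans _ (esym (E 1 0))).
  have swap (a a' b b' c d e h m n : K) : a = a' -> b = b' ->
    a * m + c * d + (e * h + n * b) = a' * m + e * h + (c * d + n * b').
    by move=> <- <-; ring.
  exact: (swap _ _ _ _ _ _ _ _ _ _ (IHf q Uq) (IHg q Uq)).
- have E i := loc i _ _ fg.
  apply: (etrans (esym (loc 0 _ _ (E 1) q Uq))); apply: (etrans _ (loc 1 _ _ (E 0) q Uq)).
  exact: IHf.
Qed.

Lemma taylor_dx q f : dx (taylor q f) = taylor q (pderiv 0 f).
Proof. by apply: jetP => i j; rewrite /dx /taylor iterSr. Qed.

Lemma smooth_iter f n i : smooth f -> smooth (iter n (pderiv i) f).
Proof. by move=> sf; elim: n => [//|n IH]; exact: smooth_pderiv. Qed.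

(** [taylor] applies the x-derivatives innermost, so here, unlike for [dx], the extra y-derivative
    has to be moved past all of them. *)
Lemma taylor_dy q f : smooth f -> U q -> dy (taylor q f) = taylor q (pderiv 1 f).
Proof.
move=> sf Uq; apply: jetP => i j; rewrite /dy /taylor iterSr.
have loc k n (u v : 'V -> K) : (forall z, U z -> u z = v z) ->
    forall z, U z -> iter n (pderiv k) u z = iter n (pderiv k) v z.
  by move=> uv; elim: n => [|n IH]; [exact: uv|exact: (pderiv_local k oU IH)].
apply: (loc 1 j _ _ _ q Uq) => {q Uq}.
elim: i => [//|i IH] q Uq; rewrite !iterS.
rewrite -(smooth_pderivC (smooth_iter i 0 sf) Uq).
exact: (pderiv_local 0 oU IH Uq).
Qed.

Lemma taylor_eps q f : eps (taylor q f) = f q. Proof. by []. Qed.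

(** The defects of additivity form a class of jets with value 0, stable under both derivations
    because partial derivatives stay smooth. *)
Lemma taylorD q f g : smooth f -> smooth g -> U q ->
  taylor q (f + g) = taylor q f + taylor q g.
Proof.
move=> sf sg Uq; apply/eqP; rewrite -subr_eq0; apply/eqP.
apply: (@jet_bisim _ (fun u => exists f g, [/\ smooth f, smooth g &
  u = taylor q (f + g) - (taylor q f + taylor q g)])); last by exists f, g.
  move=> _ [u [v [su sv ->]]]; rewrite epsD epsN epsD !taylor_eps.
  exact: subrr.
move=> _ [u [v [su sv ->]]]; split.
  exists (pderiv 0 u), (pderiv 0 v); split; try exact: smooth_pderiv.
  rewrite dxD dxN dxD !taylor_dx; congr (_ - _).
  by apply: (taylor_local oU) => // z Uz; exact: pderiv_add.
exists (pderiv 1 u), (pderiv 1 v); split; try exact: smooth_pderiv.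
rewrite dyD dyN dyD !taylor_dy //; last exact: smooth_add.
congr (_ - _).
by apply: (taylor_local oU) => // z Uz; exact: pderiv_add.
Qed.

(** The jet product is determined by values and the Leibniz rule, which the product of functions
    satisfies as well. *)
Lemma taylorM q f g : smooth f -> smooth g -> U q ->
  taylor q (f * g) = taylor q f * taylor q g.
Proof.
move=> sf sg Uq; apply: jetP => i j.
have sp h k : smooth h -> smooth (pderiv k h) by exact: smooth_pderiv.
have TM k u v : smooth u -> smooth v -> taylor q (pderiv k (u * v)) =
    taylor q (pderiv k u * v) + taylor q (u * pderiv k v).
  move=> su sv; have su' := sp u k su; have sv' := sp v k sv.
  apply: (etrans (taylor_local oU (fun z Uz => pderiv_mul k su sv Uz) Uq)).
  exact: (taylorD (smooth_mul su' sv) (smooth_mul su sv') Uq).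
elim: i j f g sf sg => [|i IH] j f g sf sg; last first.
  have sf' := sp f 0 sf; have sg' := sp g 0 sg.
  have e1 := congr1 (fun u : jet K => u i j) (etrans (taylor_dx q (f * g)) (TM 0 f g sf sg)).
  have := dxM (taylor q f) (taylor q g); rewrite (taylor_dx q f) (taylor_dx q g).
  move=> /(congr1 (fun u : jet K => u i j)) e2.
  apply: (etrans e1); apply: (etrans _ (esym e2)).
  exact: (congr2 +%R (IH j _ _ sf' sg) (IH j _ _ sf sg')).
elim: j f g sf sg => [|j IH] f g sf sg; first by [].
have sf' := sp f 1 sf; have sg' := sp g 1 sg.
have e1 := congr1 (fun u : jet K => u 0%N j)
  (etrans (taylor_dy (smooth_mul sf sg) Uq) (TM 1 f g sf sg)).
have := dyM (taylor q f) (taylor q g); rewrite (taylor_dy sf Uq) (taylor_dy sg Uq).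
move=> /(congr1 (fun u : jet K => u 0%N j)) e2.
apply: (etrans e1); apply: (etrans _ (esym e2)).
exact: (congr2 +%R (IH _ _ sf' sg) (IH _ _ sf sg')).
Qed.

Lemma taylorN q f : smooth f -> U q -> taylor q (- f) = - taylor q f.
Proof.
move=> sf Uq; have -> : - f = cst (-1) * f by apply/funext => z; rewrite -[RHS]/(-1 * f z) mulN1r.
rewrite (taylorM (smooth_cst _) sf Uq).
by rewrite taylor_cst jcstN -joneE mulN1r.
Qed.

Lemma smooth_opp f : smooth f -> smooth (- f).
Proof.
move=> sf; have -> : - f = cst (-1) * f by apply/funext => z; rewrite -[RHS]/(-1 * f z) mulN1r.
by apply: smooth_mul => //; exact: smooth_cst.
Qed.

Lemma taylorB q f g : smooth f -> smooth g -> U q ->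
  taylor q (f - g) = taylor q f - taylor q g.
Proof. by move=> sf sg Uq; rewrite taylorD ?taylorN //; exact: smooth_opp. Qed.

Definition vcoord (V : 'V -> 'V) i : 'V -> K := fun z => V z 0 i.
Definition taylor_field q (V : 'V -> 'V) : jet K * jet K :=
  (taylor q (vcoord V 0), taylor q (vcoord V 1)).

Lemma sum2E (F : 'I_2 -> K) : \sum_i F i = F 0 + F 1.
Proof.
rewrite !big_ord_recl big_ord0 addr0.
by congr (F _ + F _); apply: val_inj.
Qed.

Lemma taylor_field_lin q a (V W : 'V -> 'V) : U q ->
  analytic_vfield U V -> analytic_vfield U W ->
  taylor_field q (a *: V + W) = fcomb (jcst a) (taylor_field q V) 1 (taylor_field q W).
Proof.
move=> Uq [aV _] [aW _].
have E i : taylor q (vcoord (a *: V + W) i) = jcst a * taylor q (vcoord V i) + taylor q (vcoord W i).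
  have sV := smooth_analytic (aV i); have sW := smooth_analytic (aW i).
  have sa : smooth (cst a) by exact: smooth_cst.
  rewrite -(taylor_cst q) -(taylorM sa sV Uq) -(taylorD (smooth_mul sa sV) sW Uq).
  by congr taylor; apply/funext => z; rewrite /vcoord !mxE.
by rewrite /taylor_field !E /fcomb /= !mul1r.
Qed.

Lemma taylor_field_bracket q (V W : 'V -> 'V) : U q ->
  analytic_vfield U V -> analytic_vfield U W ->
  taylor_field q (vf_bracket U V W) = fbr (taylor_field q V) (taylor_field q W).
Proof.
move=> Uq [aV _] [aW _].
have sV i : smooth (vcoord V i) by exact: smooth_analytic (aV i).
have sW i : smooth (vcoord W i) by exact: smooth_analytic (aW i).
have E i : taylor q (vcoord (vf_bracket U V W) i) =
    act (taylor_field q V) (taylor q (vcoord W i)) - act (taylor_field q W) (taylor q (vcoord V i)).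
  have sm h k l : smooth h -> smooth k -> smooth (h * pderiv l k).
    by move=> sh sk; apply: smooth_mul => //; exact: smooth_pderiv.
  have smD h0 h1 k : smooth h0 -> smooth h1 -> smooth k ->
      smooth (h0 * pderiv 0 k + h1 * pderiv 1 k).
    by move=> s0 s1 sk; apply: smooth_add; exact: sm.
  have actE h0 h1 k : smooth h0 -> smooth h1 -> smooth k ->
      taylor q (h0 * pderiv 0 k + h1 * pderiv 1 k) =
      act (taylor q h0, taylor q h1) (taylor q k).
    move=> s0 s1 sk; apply: (etrans (taylorD (sm _ _ 0 s0 sk) (sm _ _ 1 s1 sk) Uq)).
    exact: (congr2 +%R
      (etrans (taylorM s0 (smooth_pderiv 0 sk) Uq) (congr1 ( *%R _) (esym (taylor_dx q k))))
      (etrans (taylorM s1 (smooth_pderiv 1 sk) Uq) (congr1 ( *%R _) (esym (taylor_dy sk Uq))))).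
  have loc z : U z -> vcoord (vf_bracket U V W) i z =
     ((vcoord V 0 * pderiv 0 (vcoord W i) + vcoord V 1 * pderiv 1 (vcoord W i)) -
      (vcoord W 0 * pderiv 0 (vcoord V i) + vcoord W 1 * pderiv 1 (vcoord V i))) z.
    move=> Uz; rewrite {1}/vcoord {1}/vf_bracket (mem_set Uz) mxE.
    rewrite (vf_act_coordf W i) (vf_act_coordf V i).
    exact: (congr2 (fun a b => a - b) (sum2E _) (sum2E _)).
  apply: (etrans (taylor_local oU loc Uq)).
  apply: (etrans (taylorB (smD _ _ _ (sV 0) (sV 1) (sW i)) (smD _ _ _ (sW 0) (sW 1) (sV i)) Uq)).
  exact: (congr2 (fun a b => a - b) (actE _ _ _ (sV 0) (sV 1) (sW i)) (actE _ _ _ (sW 0) (sW 1) (sV i))).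
by rewrite /taylor_field !E.
Qed.

Lemma taylor_field_det q (V W : 'V -> 'V) : U q ->
  analytic_vfield U V -> analytic_vfield U W ->
  fdet (taylor_field q V) (taylor_field q W) =
  taylor q (vcoord V 0 * vcoord W 1 - vcoord V 1 * vcoord W 0).
Proof.
move=> Uq [aV _] [aW _].
have sV i : smooth (vcoord V i) by exact: smooth_analytic (aV i).
have sW i : smooth (vcoord W i) by exact: smooth_analytic (aW i).
by rewrite taylorB ?taylorM //; apply: smooth_mul.
Qed.

End Smooth.

(** * Vector fields on [U] represented by their Taylor jets *)

Unset Implicit Arguments.

Theorem proposition3p2 (R : realType) (U : set 'rV[complexF R]_2)
    (L S Rad : set ('rV[complexF R]_2 -> 'rV[complexF R]_2)) :
  open U -> connected U -> U !=set0 ->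
  L `<=` analytic_vfield U ->
  lie_subalgebra (vf_bracket U) L -> finite_dimensional L ->
  proper_levi_decomposition (vf_bracket U) L S Rad ->
  lie_isomorphic (vf_bracket U) (@mx_commutator (complexF R) 2)
    S (sl 2 (complexF R)).
Proof.
move=> oU cU _ LU sL _.
(* The index set is [U] itself. Faithfulness is the identity theorem for each coefficient; extension
   by zero outside [U] places a point of nonvanishing of a nonzero field inside [U]; a determinant
   vanishing on the open set [U] has zero jets there. *)
apply: (@levi_sl2 _ _ _ L {q | U q} (fun q V => taylor_field (projT1 q) V) sL).
- by move=> [q Uq] a x y /LU Lx /LU Ly; exact: (taylor_field_lin oU a Uq Lx Ly).
- by move=> [q Uq] x y /LU Lx /LU Ly; exact: (taylor_field_bracket oU Uq Lx Ly).
- move=> [q Uq] x /LU [ax x0] [E0 E1]; apply/funext => z; apply/rowP => i; rewrite [RHS]mxE.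
  have [Uz|nUz] := pselect (U z); last by rewrite x0 // mxE.
  have ai := analytic_identity oU cU (ax i) Uq.
  by case: (ord2E i) ai => -> ai; apply: ai.
- move=> x /LU [ax x0] xn0; apply: contrapT => h; apply: xn0.
  apply/funext => z; apply/rowP => i; rewrite [RHS]mxE.
  have [Uz|nUz] := pselect (U z); last by rewrite x0 // mxE.
  apply/eqP/negPn/negP => n; apply: h; exists (exist _ z Uz).
  by case: (ord2E i) n => ->; [left|right].
move=> x y /LU Lx /LU Ly h [q Uq] /=.
rewrite (taylor_field_det oU Uq Lx Ly) (taylor_local oU (g := cst 0)) //.
  by rewrite taylor_cst; apply: jetP => -[|?] [|?].
move=> z Uz; have := h (exist _ z Uz); rewrite /= (taylor_field_det oU Uz Lx Ly).
by rewrite taylor_eps.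
Qed.
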